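(* Let $0\neq x\in L^1(\widetilde{\mathcal{M}},\tau)+\mathcal{M}$, and let $a$ be a closed operator affiliated with $\mathcal{M}$. Then $a$ is $\tau$-measurable if and only if $a$ is $\tau_x$-measurable.
   Context: $\mathcal{M}$ is a semi-finite von Neumann algebra acting on a Hilbert space $\mathcal{H}$, equipped with a semi-finite normal faithful trace $\tau$; $\mathcal{M}_P$ is its lattice of projections. A closed operator $a$ affiliated with $\mathcal{M}$, with domain $D(a)$, is $\tau$-measurable if for every $\delta>0$ there is $p\in\mathcal{M}_P$ with $p\mathcal{H}\subset D(a)$, $\|ap\|<\infty$ and $\tau(1-p)\le\delta$. The set of $\tau$-measurable operators is $\widetilde{\mathcal{M}}$. For $a\in\widetilde{\mathcal{M}}$ and $t>0$, $\mu_t(a)=\inf\{\|ap\|: p\in\mathcal{M}_P,\ \tau(1-p)\le t\}$. $L^1(\widetilde{\mathcal{M}},\tau)$ is the set of $a\in\widetilde{\mathcal{M}}$ with $\tau(|a|)=\int_0^\infty\mu_t(a)\,dt<\infty$. For the fixed $x$, define $\tau_x:\widetilde{\mathcal{M}}\to[0,\infty]$ by $\tau_x(a)=\int_0^\infty\mu_t(a)\mu_t(x)\,dt$. A closed operator $a$ affiliated with $\mathcal{M}$ is $\tau_x$-measurable if for every $\delta>0$ there is $p\in\mathcal{M}_P$ with $p\mathcal{H}\subset D(a)$, $\|ap\|<\infty$ and $\tau_x(1-p)\le\delta$. *)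

(* Defs.v *)
From HB Require Import structures.
From mathcomp Require Import all_boot all_order all_algebra.
From mathcomp Require Import sesquilinear complex.
From mathcomp Require Import all_classical all_reals all_analysis.

Set Implicit Arguments.
Unset Strict Implicit.
Unset Printing Implicit Defensive.

Import Order.TTheory GRing.Theory Num.Theory Num.Def.

Local Open Scope classical_set_scope.
Local Open Scope ring_scope.

(* A complex Hilbert space is a complete normed space H over R[i] together with
   an inner product, linear in its first argument, inducing the norm.  The norm
   of H takes its values in R[i]. *)
Definition is_inner_product (R : realType) (H : completeNormedModType R[i])
    (ip : {dot H for (@conjC R[i])}) : Prop :=
  forall u : H, `|u| ^+ 2 = ip u u.

Section BoundedOperators.
Context {R : realType} {H : completeNormedModType R[i]}.
Variable ip : {dot H for (@conjC R[i])}.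
Implicit Types (S T U p : H -> H) (M : set (H -> H)) (tau : (H -> H) -> \bar R).

Definition bounded_op S : Prop := linear S /\ continuous S.

Definition is_adjoint S T : Prop := forall u v : H, ip (S u) v = ip u (T v).

Definition commutant M : set (H -> H) :=
  [set T | bounded_op T /\ forall S, M S -> T \o S = S \o T].

Record von_neumann_algebra M : Prop := {
  vna_bounded : forall S, M S -> bounded_op S ;
  vna_one : M idfun ;
  vna_add : forall S T, M S -> M T -> M (S \+ T) ;
  vna_scale : forall (z : R[i]) S, M S -> M (z \*: S) ;
  vna_mul : forall S T, M S -> M T -> M (S \o T) ;
  vna_adjoint : forall S, M S -> exists2 T, M T & is_adjoint S T ;
  vna_bicommutant : commutant (commutant M) = M }.

Definition positive_op S : Prop := forall u : H, 0 <= ip (S u) u.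

Definition le_op S T : Prop := positive_op (T \- S).

Definition pos_cone M : set (H -> H) := [set S | M S /\ positive_op S].

Definition is_projection p : Prop := p \o p = p /\ is_adjoint p p.

Definition projections M : set (H -> H) := [set p | M p /\ is_projection p].

Definition is_unitary U : Prop :=
  exists V, [/\ is_adjoint U V, U \o V = idfun & V \o U = idfun].

Definition directed_op (D : set (H -> H)) : Prop :=
  D !=set0 /\
  forall S T, D S -> D T -> exists2 W, D W & le_op S W /\ le_op T W.

Definition is_lub_op M (D : set (H -> H)) S : Prop :=
  [/\ pos_cone M S, forall T, D T -> le_op T S &
      forall T, pos_cone M T -> (forall W, D W -> le_op W T) -> le_op S T].

(* Only the restriction of tau to the positive cone of M is meaningful.
   In trace_scale the convention is 0 * +oo = 0. *)
Record nsf_trace M tau : Prop := {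
  trace_ge0 : forall S, pos_cone M S -> (0 <= tau S)%E ;
  trace_add : forall S T, pos_cone M S -> pos_cone M T ->
    tau (S \+ T) = (tau S + tau T)%E ;
  trace_scale : forall (c : R) S, 0 <= c -> pos_cone M S ->
    tau ((c%:C)%C \*: S) = (c%:E * tau S)%E ;
  trace_tracial : forall S T, M S -> M T -> is_adjoint S T ->
    tau (T \o S) = tau (S \o T) ;
  trace_normal : forall (D : set (H -> H)) S,
    D `<=` pos_cone M -> directed_op D -> is_lub_op M D S ->
    tau S = ereal_sup (tau @` D) ;
  trace_faithful : forall S, pos_cone M S -> tau S = 0%E -> S = \0 ;
  trace_semifinite : forall S, pos_cone M S -> S <> \0 ->
    exists T, [/\ pos_cone M T, T <> \0, le_op T S & (tau T < +oo)%E] }.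

End BoundedOperators.

(* Possibly unbounded and partially defined operators on H are represented by
   their graphs. *)
Section UnboundedOperators.
Context {R : realType} {H : completeNormedModType R[i]}.
Variable ip : {dot H for (@conjC R[i])}.
Implicit Types (a b x : set (H * H)) (p : H -> H) (M : set (H -> H)).

Definition graph (S : H -> H) : set (H * H) := [set w | w.2 = S w.1].

Definition is_operator a : Prop :=
  [/\ a (0, 0),
      forall (z : R[i]) (u v u' v' : H),
        a (u, v) -> a (u', v') -> a (z *: u + u', z *: v + v') &
      forall u v v' : H, a (u, v) -> a (u, v') -> v = v'].

Definition closed_operator a : Prop := is_operator a /\ closed a.

Definition dom a : set H := [set u | exists v, a (u, v)].

(* U^* a U = a for every unitary U in the commutant of M. *)
Definition affiliated M a : Prop :=
  forall U : H -> H, commutant M U -> is_unitary ip U ->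
  forall u v : H, a (u, v) <-> a (U u, U v).

Definition comp_op a p : set (H * H) := [set w | a (p w.1, w.2)].

Definition add_op a b : set (H * H) :=
  [set w | exists v v', [/\ a (w.1, v), b (w.1, v') & w.2 = v + v']].

(* The sum in the algebra of tau-measurable operators: the closure of the
   algebraic sum. *)
Definition strong_sum a b : set (H * H) := closure (add_op a b).

(* The operator norm; it is +oo unless the operator is everywhere defined and
   bounded, so that opnorm (comp_op a p) < +oo entails pH `<=` dom a. *)
Definition opnorm a : \bar R :=
  ereal_inf [set c%:E | c in [set c : R | 0 <= c /\
    forall u : H, exists2 v, a (u, v) & `|v| <= (c%:C)%C * `|u|]].

(* w is the weight applied to 1 - p: tau itself or tau_x. *)
Definition measurable_wrt M (w : (H -> H) -> \bar R) a : Prop :=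
  [/\ closed_operator a, affiliated M a &
      forall delta : R, 0 < delta ->
        exists p, [/\ projections ip M p, range p `<=` dom a,
          (opnorm (comp_op a p) < +oo)%E & (w (idfun \- p)%R <= delta%:E)%E]].

Variables (M : set (H -> H)) (tau : (H -> H) -> \bar R).

Definition tau_measurable a : Prop := measurable_wrt M tau a.

Definition mu (t : R) a : \bar R :=
  ereal_inf [set opnorm (comp_op a p) | p in
    [set p | projections ip M p /\ (tau (idfun \- p)%R <= t%:E)%E]].

Definition L1 a : Prop :=
  tau_measurable a /\
  (\int[lebesgue_measure]_(t in `]0%R, +oo[) mu t a < +oo)%E.

Definition L1_plus_M : set (set (H * H)) :=
  [set x | exists y z, [/\ L1 y, M z & x = strong_sum y (graph z)]].

Definition tau_x x a : \bar R :=
  (\int[lebesgue_measure]_(t in `]0%R, +oo[) (mu t a * mu t x))%E.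

Definition tau_x_measurable x a : Prop :=
  measurable_wrt M (fun S => tau_x x (graph S)) a.

End UnboundedOperators.

(* Main.v *)
(* For a projection q = 1 - p of M, mu_t(q) <= 1, and mu_t(q) = 0 when
   t >= tau(q), so tau_x(q) is at most the integral of mu_t(x) over
   0 < t < tau(q), which is small with tau(q) because mu_t(y + z) <= mu_t(y) + |z|
   is integrable near 0.  Conversely, if |q p'| <= 1/2 then q <= 2 q (1 - p') q,
   hence tau(q) <= 2 tau(1 - p') by traciality; so mu_t(q) >= 1/2 for
   2 t < tau(q), and tau_x(q) is at least half of the integral of mu_t(x) over
   0 < t < tau(q) / 2.

   It remains to see that mu_t(x) > 0 for small t.  Let K = 1 - (1 + x^* x)^-1,
   which comes from the orthogonal projection of H x 0 onto the closed graph
   of x.  It commutes with the unitaries of M', so it lies in M'' = M; it vanishes only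
   if x = 0, and <K w, w> <= |x w|^2.  Choose T with 0 <> T <= K and tau(T)
   finite.  If |x p| <= e and tau(1 - p) <= e, then T p T <= e^2 T and
   tau (T (1 - p) T) = tau ((1 - p) T^2 (1 - p)) <= |T|^2 e.  Letting e tend
   to 0 gives tau(T^2) = 0, a contradiction. *)

Require Import Defs.
From HB Require Import structures.
From mathcomp Require Import all_boot all_order all_algebra.
From mathcomp Require Import sesquilinear complex.
From mathcomp Require Import all_classical all_reals all_analysis.
From mathcomp Require Import measurable_realfun ring lra.

Set Implicit Arguments.
Unset Strict Implicit.
Unset Printing Implicit Defensive.

Import Order.TTheory GRing.Theory Num.Theory Num.Def.
Import numFieldNormedType.Exports.

Local Open Scope classical_set_scope.
Local Open Scope ring_scope.

(** * Elementary rules for maps given as plain functions with a proof of linearity *)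

Section LinearMaps.
Context {K : nzRingType} {V : lmodType K}.
Variable (S : V -> V).
Hypothesis linS : linear S.

Lemma linear_fun0 : S 0 = 0.
Proof. by have := linS (-1) 0 0; rewrite scaler0 addr0 scaleN1r addNr. Qed.

Lemma linear_funD u v : S (u + v) = S u + S v.
Proof. by have := linS 1 u v; rewrite !scale1r. Qed.

Lemma linear_funZ z u : S (z *: u) = z *: S u.
Proof. by have := linS z u 0; rewrite !addr0 linear_fun0 addr0. Qed.

Lemma linear_funN u : S (- u) = - S u.
Proof. by rewrite -!scaleN1r linear_funZ. Qed.

Lemma linear_funB u v : S (u - v) = S u - S v.
Proof. by rewrite linear_funD linear_funN. Qed.

End LinearMaps.

Lemma conjC_i (R : realType) : ('i%C : R[i])^* = - 'i%C.
Proof. by apply/eqP; rewrite eq_complex /= oppr0 !eqxx. Qed.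

(** * Cauchy-Schwarz for positive semidefinite Hermitian forms *)

Section Semidefinite.
Context {R : realType} {V : lmodType R[i]}.
Variable f : V -> V -> R[i].
Hypothesis fB : forall u v w, f (u - v) w = f u w - f v w.
Hypothesis fZ : forall z u w, f (z *: u) w = z * f u w.
Hypothesis fC : forall u v, f u v = (f v u)^*.
Hypothesis f_ge0 : forall u, 0 <= f u u.

(** Evaluating the form at [u - t (f u v) v] gives a nonnegative polynomial in the real variable
    [t]. Degeneracy is allowed because the result serves both for [ip] and for the form [ip (T x) y]
    of a positive operator [T]. *)
Lemma semidefinite_cauchy_schwarz u v : `|f u v| ^+ 2 <= f u u * f v v.
Proof.
have fBr a b c : f a (b - c) = f a b - f a c.
  by rewrite fC fB rmorphB/= -!fC.
have fZr z a b : f a (z *: b) = z^* * f a b.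
  by rewrite fC fZ rmorphM/= -fC.
pose D := `|f u v| ^+ 2; have D0 : 0 <= D by rewrite exprn_ge0.
have key t : t \is Num.real -> 0 <= f u u - t * D *+ 2 + t ^+ 2 * D * f v v.
  move=> tr; have := f_ge0 (u - (t * f u v) *: v).
  rewrite fB !fBr !fZ !fZr rmorphM/= (CrealP tr) (fC v u) /D normCK.
  by congr (0 <= _); ring.
have [v0|v0] := eqVneq (f v v) 0.
  rewrite v0 mulr0 -/D; have [->//|Dn] := eqVneq D 0.
  (* With [f v v = 0] the polynomial is affine in [t]; at this [t] it equals [- (f u u + 2)], which
     is negative. *)
  have tr : (f u u + 1) / D \is Num.real by rewrite ger0_real// divr_ge0// addr_ge0.
  have := key _ tr; rewrite v0 mulr0 addr0 divfK//.
  rewrite (_ : _ - _ = - (f u u + 2)); last by ring.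
  by rewrite oppr_ge0 lt_geF// ltr_wpDl.
have v1 : 0 < f v v by rewrite lt_def v0 f_ge0.
have := key (f v v)^-1; rewrite ger0_real ?invr_ge0// => /(_ isT).
rewrite (_ : _ + _ = f u u - D / f v v); last by field.
by rewrite subr_ge0 ler_pdivrMr.
Qed.

End Semidefinite.

(** * Inner product calculus with a real-valued norm *)

Section Hilbert.
Context {R : realType} {H : completeNormedModType R[i]}.
Variable ip : {dot H for (@conjC R[i])}.
Hypothesis hip : is_inner_product ip.
Local Notation "x %:C" := (real_complex R x) (format "x %:C") : ring_scope.

(** The norm of [H] lies in [R[i]], whose order is only partial; its real part loses nothing and
    takes values where infima and linear arithmetic are available. *)
Definition rnorm (u : H) : R := complex.Re `|u|.

Lemma normE u : `|u| = (rnorm u)%:C.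
Proof. by rewrite RRe_real// normr_real. Qed.

Lemma rnorm_ge0 u : 0 <= rnorm u.
Proof. by rewrite -ler0c -normE. Qed.

Lemma rnorm0 : rnorm 0 = 0.
Proof. by rewrite /rnorm normr0. Qed.

Lemma rnorm_eq0 u : rnorm u = 0 -> u = 0.
Proof. by move=> u0; apply/eqP; rewrite -normr_eq0 normE u0. Qed.

Lemma rnormD u v : rnorm (u + v) <= rnorm u + rnorm v.
Proof. by rewrite -lecR rmorphD/= -!normE ler_normD. Qed.

Lemma rnormN u : rnorm (- u) = rnorm u.
Proof. by rewrite /rnorm normrN. Qed.

Lemma ip_norm u : ip u u = (rnorm u ^+ 2)%:C.
Proof. by rewrite -hip normE rmorphXn. Qed.

Lemma rnorm_sqr u : rnorm u ^+ 2 = complex.Re (ip u u).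
Proof. by rewrite ip_norm. Qed.

Lemma rnormZ (c : R) u : 0 <= c -> rnorm (c%:C *: u) = c * rnorm u.
Proof.
move=> c0; apply: complexI; rewrite rmorphM/= -!normE normrZ ger0_norm//.
by rewrite ler0c.
Qed.

Lemma ipDl u v w : ip (u + v) w = ip u w + ip v w. Proof. exact: linearDl. Qed.
Lemma ipDr u v w : ip w (u + v) = ip w u + ip w v. Proof. exact: linearDr. Qed.
Lemma ipBl u v w : ip (u - v) w = ip u w - ip v w. Proof. exact: linearBl. Qed.
Lemma ipBr u v w : ip w (u - v) = ip w u - ip w v. Proof. exact: linearBr. Qed.
Lemma ip0l w : ip 0 w = 0. Proof. exact: linear0l. Qed.
Lemma ip0r w : ip w 0 = 0. Proof. exact: linear0r. Qed.
Lemma ipZl z u w : ip (z *: u) w = z * ip u w. Proof. exact: linearZl_LR. Qed.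
Lemma ipZr z u w : ip w (z *: u) = z^* * ip w u. Proof. exact: linearZr_LR. Qed.
Lemma ipC u v : ip u v = (ip v u)^*.
Proof. by rewrite hermC expr0 mul1r. Qed.

Lemma ip_eq0 u : ip u u = 0 -> u = 0.
Proof. by move/eqP; rewrite dnorm_eq0 => /eqP. Qed.

Lemma ip_inj u v : (forall w, ip u w = ip v w) -> u = v.
Proof.
by move=> e; apply/eqP; rewrite -subr_eq0; apply/eqP/ip_eq0; rewrite ipBl e subrr.
Qed.

Lemma ip_injr u v : (forall w, ip w u = ip w v) -> u = v.
Proof. by move=> e; apply: ip_inj => w; rewrite ipC e -ipC. Qed.

Lemma cauchy_schwarz u v : `|ip u v| <= `|u| * `|v|.
Proof.
rewrite -ler_sqr ?nnegrE ?mulr_ge0// exprMn !hip.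
apply: semidefinite_cauchy_schwarz => *.
- exact: ipBl.
- exact: ipZl.
- exact: ipC.
- by rewrite -hip exprn_ge0.
Qed.

Lemma rnorm_le u c : 0 <= c -> rnorm u ^+ 2 <= c ^+ 2 -> rnorm u <= c.
Proof. by move=> c0; rewrite ler_sqr ?nnegrE ?rnorm_ge0. Qed.

End Hilbert.

(** * Orthogonal projection of [(u, 0)] onto a closed subspace of [H * H] *)

Section GraphProjection.
Context {R : realType} {H : completeNormedModType R[i]}.
Variable ip : {dot H for (@conjC R[i])}.
Hypothesis hip : is_inner_product ip.
Local Notation "x %:C" := (real_complex R x) (format "x %:C") : ring_scope.

Lemma parallelogram (a b : H) :
  rnorm (a - b) ^+ 2 = 2 * rnorm a ^+ 2 + 2 * rnorm b ^+ 2 - rnorm (a + b) ^+ 2.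
Proof.
rewrite !(rnorm_sqr hip) (ipBl ip) !(ipBr ip) (ipDl ip) !(ipDr ip) !raddfB !raddfD/=.
ring.
Qed.

Lemma rnorm_sqrBZ (a b : H) (z : R[i]) : rnorm (a - z *: b) ^+ 2 =
  rnorm a ^+ 2 - 2 * complex.Re (z^* * ip a b) +
  (complex.Re z ^+ 2 + complex.Im z ^+ 2) * rnorm b ^+ 2.
Proof.
rewrite [LHS](rnorm_sqr hip) (ipBl ip) !(ipBr ip) !(ipZl ip) !(ipZr ip) !(ip_norm hip).
rewrite (ipC ip b a).
case: (ip a b) z (rnorm a) (rnorm b) => x y [p q] r s /=; ring.
Qed.

Lemma rnorm_half (a : H) : rnorm a ^+ 2 = 4 * rnorm (2^-1 *: a) ^+ 2.
Proof.
rewrite (_ : 2^-1 = (2^-1)%:C); last by rewrite fmorphV/= (rmorph_nat (real_complex R) 2).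
by rewrite rnormZ ?invr_ge0//; field.
Qed.

(** The bound is the one that the parallelogram law gives for a minimizing sequence with error
    [n.+1%:R^-1]. It makes [g] Cauchy, and [H] is complete. *)
Lemma cvg_of_sqr_dist (g : nat -> H) :
  (forall n m, rnorm (g n - g m) ^+ 2 <= 2 * n.+1%:R^-1 + 2 * m.+1%:R^-1) ->
  exists l : H, g @ \oo --> l.
Proof.
move=> hg; suff : cvg (g @ \oo) by move=> gl; exists (lim (g @ \oo)).
apply/cauchy_cvgP/cauchy_ballP => e e0; near_simpl.
have [er e0'] : e = (complex.Re e)%:C /\ 0 < complex.Re e.
  by have := e0; rewrite ltcE /= => /andP[/eqP ei er]; case: e e0 ei er => x y /= _ -> xr.
(* Each of the two terms of the bound may use up half of the squared radius. *)
have e4 : 0 < complex.Re e ^+ 2 / 4 by rewrite divr_gt0// exprn_gt0.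
have nf := near_infty_natSinv_lt (PosNum e4).
near=> n m => /=; rewrite -ball_normE /= normE er ltcR.
rewrite -(@ltr_pXn2r _ 2)// ?nnegrE ?rnorm_ge0// ?ltW//.
apply: le_lt_trans (hg n m) _.
have : n.+1%:R^-1 < complex.Re e ^+ 2 / 4 by near: n; exact: nf.
have : m.+1%:R^-1 < complex.Re e ^+ 2 / 4 by near: m; exact: nf.
move: (n.+1%:R^-1) (m.+1%:R^-1) (complex.Re e ^+ 2) => a b c. lra.
Unshelve. all: by end_near. Qed.

Lemma cvg_rnorm (T : Type) (F : set_system T) (FF : Filter F) (f : T -> H) (l : H) :
  f @ F --> l -> (fun t => rnorm (f t)) @ F --> rnorm l.
Proof.
move=> /cvgrPdist_lt fl; apply/cvgrPdist_lt => e e0.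
have e0' : 0 < e%:C by rewrite -[0]/(0%:C) ltcR.
apply: filterS (fl _ e0') => t; rewrite normE ltcR; apply: le_lt_trans.
rewrite ler_norml lerBlDr lerNl opprB lerBlDr.
rewrite -[X in rnorm X <= _ + rnorm (f t)](subrK (f t)) rnormD andbT.
by rewrite -(rnormN (l - _)) opprB -{1}[f t](subrK l) rnormD.
Qed.

Variable G : set (H * H).
Hypothesis G0 : G (0, 0).
Hypothesis Glin : forall (z : R[i]) (u v u' v' : H),
  G (u, v) -> G (u', v') -> G (z *: u + u', z *: v + v').
Hypothesis Gclosed : closed G.

(** The product [H * H] comes without an inner product, so the squared Hilbert distance from
    [(u, 0)] is written out in components. A minimizing sequence is Cauchy by the parallelogram law,
    and its limit stays in the closed set [G]. *)
Lemma graph_minimizer u : exists w s, G (w, s) /\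
  forall w' s', G (w', s') ->
    rnorm (u - w) ^+ 2 + rnorm s ^+ 2 <= rnorm (u - w') ^+ 2 + rnorm s' ^+ 2.
Proof.
pose N (g : H * H) := rnorm (u - g.1) ^+ 2 + rnorm g.2 ^+ 2.
have N0 g : 0 <= N g by rewrite addr_ge0// sqr_ge0.
pose A := [set N g | g in G].
have hA : has_inf A.
  by split; [exists (N (0, 0)), (0, 0)|exists 0 => _ [g _ <-]].
have Nd g : G g -> inf A <= N g by move=> Gg; apply: ge_inf; [exact: hA.2|exists g].
have /choice [g gP] n : exists g, G g /\ N g < inf A + n.+1%:R^-1.
  have n0 : 0 < n.+1%:R^-1 :> R by rewrite invr_gt0.
  by have [_ [g Gg <-] gn] := inf_adherent n0 hA; exists g.
have dist n m : rnorm ((g n).1 - (g m).1) ^+ 2 + rnorm ((g n).2 - (g m).2) ^+ 2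
    <= 2 * n.+1%:R^-1 + 2 * m.+1%:R^-1.
  have [Gn Nn] := gP n; have [Gm Nm] := gP m.
  (* The value of [N] at the midpoint is at least [inf A]; subtracting four times this in the
     parallelogram law leaves only the two errors. *)
  have Gmid : G (2^-1 *: ((g n).1 + (g m).1), 2^-1 *: ((g n).2 + (g m).2)).
    have h1 : G (1 *: (g n).1 + (g m).1, 1 *: (g n).2 + (g m).2).
      by apply: Glin; rewrite -surjective_pairing.
    by have := Glin 2^-1 h1 G0; rewrite !scale1r !addr0.
  have := Nd _ Gmid; rewrite /N/= => hmid.
  have e1 : (g n).1 - (g m).1 = (u - (g m).1) - (u - (g n).1).
    by rewrite opprB [RHS]addrC subrKA.
  rewrite e1 (parallelogram (u - (g m).1)) (parallelogram (g n).2).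
  rewrite [rnorm ((g n).2 + _) ^+ 2]rnorm_half [rnorm (_ + (_ - _)) ^+ 2]rnorm_half.
  have -> : 2^-1 *: (u - (g m).1 + (u - (g n).1)) = u - 2^-1 *: ((g n).1 + (g m).1).
    have h2 : 2^-1 + 2^-1 = 1 :> R[i] by field.
    by rewrite addrACA -opprD scalerBr scalerDr -scalerDl h2 scale1r [(g m).1 + _]addrC.
  move: Nn Nm hmid; rewrite /N; move: (n.+1%:R^-1) (m.+1%:R^-1) => a b; lra.
have [w gw] : exists l : H, (fun n => (g n).1) @ \oo --> l.
  apply: cvg_of_sqr_dist => n m; apply: le_trans (dist n m).
  by rewrite lerDl sqr_ge0.
have [s gs] : exists l : H, (fun n => (g n).2) @ \oo --> l.
  apply: cvg_of_sqr_dist => n m; apply: le_trans (dist n m).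
  by rewrite lerDr sqr_ge0.
exists w, s; split.
  have gl : g @ \oo --> (w, s).
    rewrite (_ : g = fun n => ((g n).1, (g n).2)); last by apply/funext => n; case: (g n).
    exact: cvg_pair.
  by apply: (closed_cvg _ Gclosed _ _ gl); apply: nearW => n; exact: (gP n).1.
(* It remains to see that [N (w, s)] does not exceed [inf A]. Half of a supposed gap is used for the
   convergence of [N (g n)], half for its distance to [inf A]. *)
move=> w' s' /Nd; apply: le_trans; rewrite leNgt; apply/negP => lt.
pose e := N (w, s) - inf A; have e0 : 0 < e / 2 by rewrite divr_gt0// subr_gt0.
have cN : (fun n => N (g n)) @ \oo --> N (w, s).
  apply: cvgD; rewrite expr2; under eq_fun do rewrite expr2.
    by apply: cvgM; apply: cvg_rnorm; apply: cvgB => //; exact: cvg_cst.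
  by apply: cvgM; apply: cvg_rnorm.
move/cvgrPdist_lt : cN => /(_ _ e0) h1.
have h2 := near_infty_natSinv_lt (PosNum e0).
near \oo => n.
have : `|N (w, s) - N (g n)| < e / 2 by near: n; exact: h1.
have : n.+1%:R^-1 < e / 2 by near: n; exact: h2.
rewrite ltr_norml => lt1 /andP[_].
have [_] := gP n; move: lt1; rewrite /e.
by move: (n.+1%:R^-1) (N (g n)) (N (w, s)) => a b c; lra.
Unshelve. all: by end_near. Qed.

(** First-order condition at the minimizer: moving it by [t d] times [(w', s')], where [d] is the
    defect of orthogonality, changes the squared distance by [t D (t Q - 2)] with [D] the squared
    modulus of [d]. This is negative for small [t > 0] unless [D = 0]. *)
Lemma graph_projection u : exists w s, G (w, s) /\
  forall w' s', G (w', s') -> ip (u - w) w' = ip s s'.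
Proof.
have [w [s [Gws mini]]] := graph_minimizer u; exists w, s; split => // w' s' G'.
pose d := ip (u - w) w' - ip s s'; suff : d = 0 by move/eqP; rewrite subr_eq0 => /eqP.
pose Q := rnorm w' ^+ 2 + rnorm s' ^+ 2.
have Q0 : 0 <= Q by rewrite addr_ge0// sqr_ge0.
pose D := complex.Re d ^+ 2 + complex.Im d ^+ 2.
have D0 : 0 <= D by rewrite addr_ge0// sqr_ge0.
have key t : 0 <= t * D * (t * Q - 2).
  have := mini _ _ (Glin (t%:C * d) G' Gws).
  rewrite (_ : u - (_ *: w' + w) = (u - w) - (t%:C * d) *: w'); last by rewrite opprD addrCA addrC.
  rewrite (_ : _ *: s' + s = s - (- (t%:C * d)) *: s'); last by rewrite scaleNr opprK addrC.
  rewrite -subr_ge0 !rnorm_sqrBZ; congr (_ <= _).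
  rewrite /D /Q /d; move: (rnorm w') (rnorm s') (rnorm s) (rnorm (u - w)).
  by case: (ip (u - w) w') (ip s s') => x y [p q] a b c e /=; ring.
suff D00 : D = 0.
  by apply/eqP; rewrite -normr_eq0 -sqrf_eq0 -add_Re2_Im2 -/D D00.
apply/eqP; rewrite eq_le D0 andbT leNgt; apply/negP => Dp.
(* The choice [t = (Q + 1)^-1] gives [t Q < 1], also when [Q = 0]. *)
have Q1 : 0 < Q + 1 by rewrite ltr_wpDl.
have QD : 0 < (Q + 1)^-1 * D by rewrite mulr_gt0// invr_gt0.
have := key (Q + 1)^-1; apply/negP; rewrite -ltNge pmulr_rlt0//.
by rewrite subr_lt0 mulrC ltr_pdivrMr//; lra.
Qed.

End GraphProjection.

(** * Bounded operators, Riesz representation and adjoints *)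

Section BoundedOperators.
Context {R : realType} {H : completeNormedModType R[i]}.
Variable ip : {dot H for (@conjC R[i])}.
Hypothesis hip : is_inner_product ip.
Local Notation "x %:C" := (real_complex R x) (format "x %:C") : ring_scope.
Implicit Types S T U : H -> H.

Lemma bounded_op_bound S : bounded_op S ->
  exists2 c : R, 0 <= c & forall u, rnorm (S u) <= c * rnorm u.
Proof.
move=> [linS contS].
pose f : {linear H -> H} := HB.pack S (GRing.isLinear.Build _ _ _ _ S linS).
have := @continuous_linear_bounded _ _ _ 0 f (contS 0).
move=> /linear_boundedP /pinfty_ex_gt0[c c0 Sc].
have cE : c = (complex.Re c)%:C by rewrite RRe_real// gtr0_real.
exists (complex.Re c) => [|u]; first by rewrite -ler0c -cE ltW.
by have := Sc u; rewrite cE !normE -rmorphM lecR.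
Qed.

Lemma bound_bounded_op S (c : R) : linear S -> 0 <= c ->
  (forall u, rnorm (S u) <= c * rnorm u) -> bounded_op S.
Proof.
move=> linS c0 Sc; split => // u; apply/(@cvgrPdist_lt _ _ _ (nbhs u)) => e e0.
have c1 : 0 < (c + 1)%:C by rewrite -[0]/(0%:C) ltcR ltr_wpDl.
near=> v.
rewrite -(linear_funB linS) normE; apply: (@le_lt_trans _ _ ((c + 1)%:C * `|u - v|)).
  by rewrite normE -rmorphM lecR (le_trans (Sc _))// ler_wpM2r ?rnorm_ge0// lerDl.
rewrite mulrC -ltr_pdivlMr//; near: v.
by apply: cvgr_dist_lt => //; rewrite divr_gt0.
Unshelve. all: by end_near. Qed.

Lemma bounded_op_comp S T : bounded_op S -> bounded_op T -> bounded_op (S \o T).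
Proof.
move=> [lS cS] [lT cT]; split => [z u v|u] /=; first by rewrite lT lS.
by apply: continuous_comp; [exact: cT|exact: cS].
Qed.

Lemma bounded_op_add S T : bounded_op S -> bounded_op T -> bounded_op (S \+ T).
Proof.
move=> [lS cS] [lT cT]; split => [z u v|u] /=.
  by rewrite lT lS scalerDr addrACA.
by apply: cvgD; [exact: cS|exact: cT].
Qed.

Lemma bounded_op_scale z S : bounded_op S -> bounded_op (z \*: S).
Proof.
move=> [lS cS]; split => [y u v|u] /=.
  by rewrite lS scalerDr !scalerA mulrC.
by apply: cvgZl_tmp; exact: cS.
Qed.

Lemma bounded_op_id : bounded_op (@idfun H).
Proof. by split => // u; exact: cvg_id. Qed.

Lemma closure_prod_rnorm (G : set (H * H)) p (e : R) : closure G p -> 0 < e ->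
  exists2 q, G q & rnorm (p.1 - q.1) < e /\ rnorm (p.2 - q.2) < e.
Proof.
move=> clG e0; have e0' : 0 < e%:C by rewrite -[0]/(0%:C) ltcR.
have [q [Gq [/=]]] := clG _ (nbhsx_ballx p _ e0').
by rewrite -!ball_normE/= !normE !ltcR => q1 q2; exists q.
Qed.

Lemma Re_ip_le u v : complex.Re (ip u v) <= rnorm u * rnorm v.
Proof.
rewrite -lecR rmorphM/= -!normE; apply: le_trans (cauchy_schwarz hip u v).
by apply: le_trans (normc_ge_Re _); rewrite lecR ler_norm.
Qed.

(** The representing vector is a multiple of [g = u0 - w], with [w] the projection of some [u0]
    outside the kernel onto the kernel. To reuse [graph_projection], the kernel is encoded as the
    graph of the zero map on it. *)
Lemma riesz (f : H -> R[i]) (c : R) :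
  (forall z u v, f (z *: u + v) = z * f u + f v) ->
  0 <= c -> (forall u, `|f u| <= (c * rnorm u)%:C) ->
  exists h, forall u, f u = ip u h.
Proof.
move=> flin c0 fc.
have f0 : f 0 = 0 by have := flin (-1) 0 0; rewrite scaler0 addr0 mulN1r addNr.
have [allz|/existsNP[u0 /eqP fu0]] := pselect (forall u, f u = 0).
  by exists 0 => u; rewrite allz ip0r.
pose G := [set w : H * H | f w.1 = 0 /\ w.2 = 0].
have Gclosed : closed G.
  move=> p clG; split.
    apply/eqP; rewrite -normr_eq0 -[`|_|]RRe_real ?normr_real//.
    rewrite (_ : complex.Re _ = 0)//; apply/eqP.
    rewrite eq_le -lecR -[X in _ && X]lecR RRe_real ?normr_real// normr_ge0 andbT.
    apply/ler_addgt0Pr => e e0; have eE : e = (complex.Re e)%:C by rewrite RRe_real// gtr0_real.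
    have er : 0 < complex.Re e by rewrite -ltcR -eE.
    (* Since [f q.1 = 0], the value [f p.1] is controlled by [p.1 - q.1]; dividing by [c + 1] covers
       [c = 0]. *)
    have [|q [fq _] [q1 _]] := @closure_prod_rnorm _ _ (complex.Re e / (c + 1)) clG.
      by rewrite divr_gt0// ltr_wpDl.
    rewrite add0r (_ : f p.1 = f (p.1 - q.1)); last first.
      have := flin (-1) q.1 p.1; rewrite fq mulr0 add0r => <-.
      by rewrite scaleN1r addrC.
    rewrite eE; apply: le_trans (fc _) _; rewrite lecR.
    move: q1; rewrite ltr_pdivlMr ?ltr_wpDl// mulrC => /ltW; apply: le_trans.
    by rewrite ler_wpM2r ?rnorm_ge0// lerDl.
  apply: rnorm_eq0; apply/eqP; rewrite eq_le rnorm_ge0 andbT.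
  apply/ler_addgt0Pr => e e0.
  by have [q [_ q2] [_ ]] := closure_prod_rnorm clG e0; rewrite q2 subr0 add0r => /ltW.
have [||w [s [[/= fw s0] orth]]] := @graph_projection _ _ _ hip G _ _ Gclosed u0.
- by split.
- move=> z u v u' v' [/= fu v0] [/= fu' v'0]; split => /=.
    by rewrite flin fu fu' mulr0 addr0.
  by rewrite v0 v'0 scaler0 addr0.
pose g := u0 - w.
have fg : f g = f u0.
  by have := flin (-1) w u0; rewrite fw mulr0 add0r scaleN1r addrC.
have gg : ip g g != 0.
  by rewrite dnorm_eq0; apply: contra_neq fu0 => g0; rewrite -fg g0 f0.
exists ((f g / ip g g)^* *: g) => u; rewrite ipZr conjCK.
(* This combination of [g] and [u] lies in the kernel, hence is orthogonal to [g]; solving for [f u]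
   gives the formula. *)
have : ip g ((- (f u / f g)) *: g + u) = ip s 0.
  by apply: orth; split => //=; rewrite flin mulNr divfK ?fg// addNr.
rewrite (ip0r ip) (ipC ip) => /(congr1 (@conjC R[i])); rewrite conjCK conjC0.
rewrite (ipDl ip) (ipZl ip) => /eqP; rewrite mulNr addrC subr_eq0 => /eqP ->.
have fg0 : f g != 0 by rewrite fg.
by field; rewrite ?gg ?fg0.
Qed.

Lemma adjoint_exists S : bounded_op S -> exists T, is_adjoint ip S T.
Proof.
move=> bS; have [linS _] := bS; have [c c0 Sc] := bounded_op_bound bS.
suff /choice[T ST] v : exists h, forall u, ip (S u) v = ip u h by exists T.
apply: (@riesz (fun u => ip (S u) v) (c * rnorm v)) => [z u w||u].
- by rewrite linS ipDl ipZl.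
- by rewrite mulr_ge0// rnorm_ge0.
- apply: le_trans (cauchy_schwarz hip _ _) _; rewrite !normE -rmorphM lecR.
  by rewrite mulrAC ler_wpM2r ?rnorm_ge0.
Qed.

Lemma adjoint_sym S T : is_adjoint ip S T -> is_adjoint ip T S.
Proof. by move=> ST u v; rewrite ipC -ST -ipC. Qed.

Lemma adjoint_linear S T : is_adjoint ip S T -> linear T.
Proof.
move=> ST z u v; apply: (@ip_injr _ _ ip) => w.
by rewrite -ST !ipDr !ipZr !ST.
Qed.

(** The square of [rnorm (T u)] is [ip (S (T u)) u], to which the bound of [S] applies; then
    [rnorm (T u)] cancels. *)
Lemma adjoint_bound S T (c : R) : is_adjoint ip S T ->
  (forall u, rnorm (S u) <= c * rnorm u) -> forall u, rnorm (T u) <= c * rnorm u.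
Proof.
move=> ST Sc u; have [->|T0] := eqVneq (rnorm (T u)) 0.
  by rewrite (le_trans _ (Sc u))// rnorm_ge0.
have Tp : 0 < rnorm (T u) by rewrite lt_def T0 rnorm_ge0.
rewrite -(ler_pM2l Tp) -expr2 (rnorm_sqr hip) -ST.
apply: le_trans (Re_ip_le _ _) _.
by rewrite mulrCA mulrA ler_wpM2r ?rnorm_ge0.
Qed.

Lemma adjoint_bounded S T : bounded_op S -> is_adjoint ip S T -> bounded_op T.
Proof.
move=> bS ST; have [c c0 Sc] := bounded_op_bound bS.
by apply: (bound_bounded_op (adjoint_linear ST) c0); exact: adjoint_bound Sc.
Qed.

End BoundedOperators.

(** * From commuting with unitaries to commuting with self-adjoint operators, by the Cayley
    transform *)

Section UnitarySpan.
Context {R : realType} {H : completeNormedModType R[i]}.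
Variable ip : {dot H for (@conjC R[i])}.
Hypothesis hip : is_inner_product ip.
Local Notation "x %:C" := (real_complex R x) (format "x %:C") : ring_scope.
Implicit Types (S T A K : H -> H) (M : set (H -> H)) (y : set (H * H)).

Lemma shear_continuous S : continuous S ->
  continuous (fun w : H * H => (w.1, w.2 - S w.1)).
Proof.
move=> cS w; apply: cvg_pair; first exact: cvg_fst.
apply: cvgB; first exact: cvg_snd.
by apply: (@continuous_comp _ _ _ fst S); [exact: cvg_fst|exact: cS].
Qed.

Lemma graph_closed S : continuous S -> closed (graph S).
Proof.
move=> cS; rewrite (_ : graph S = (fun w : H * H => w.2 - S w.1) @^-1` [set 0]).
  apply: closed_comp; last by apply: compact_closed; [exact: norm_hausdorff|exact: compact_set1].
  move=> w _; apply: (@continuous_comp _ _ _ (fun w => (w.1, w.2 - S w.1)) snd).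
    exact: shear_continuous.
  exact: cvg_snd.
apply/funext => w; apply/propext; rewrite /graph/=; split => [->|/eqP]; first by rewrite subrr.
by rewrite subr_eq0 => /eqP.
Qed.

Lemma commutantP M T :
  commutant M T <-> bounded_op T /\ forall S, M S -> forall u, T (S u) = S (T u).
Proof.
split=> -[bT MT]; split => // S MS; last by apply/funext => u; exact: MT.
by move=> u; have /(congr1 (fun f => f u)) := MT S MS.
Qed.

Section SelfAdjoint.
Variable A : H -> H.
Hypothesis bA : bounded_op A.
Hypothesis saA : is_adjoint ip A A.
Let linA : linear A := proj1 bA.

Lemma one_plus_sqr_inj u : u + A (A u) = 0 -> u = 0.
Proof.
move=> e; have : rnorm u ^+ 2 + rnorm (A u) ^+ 2 = 0.
  by rewrite !(rnorm_sqr hip) saA -raddfD/= -(ipDr ip) e ip0r.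
move/eqP; rewrite paddr_eq0 ?sqr_ge0// sqrf_eq0 => /andP[/eqP u0 _].
exact: rnorm_eq0.
Qed.

(** Projecting [(u, 0)] onto the graph of [A] yields [(w, A w)] with [ip (u - w) v = ip (A w) (A v)]
    for all [v], and the right side is [ip (A (A w)) v]. *)
Lemma one_plus_sqr_surj u : exists w, w + A (A w) = u.
Proof.
have [|||w [s [sE orth]]] := @graph_projection _ _ _ hip (graph A) _ _ _ u.
- by rewrite /graph/= linear_fun0.
- by move=> z v v' w w'; rewrite /graph/= => -> ->; rewrite linA.
- exact: graph_closed (proj2 bA).
move: sE; rewrite /graph/= => sE; subst s.
exists w; apply/eqP; rewrite eq_sym -subr_eq0 opprD addrA subr_eq0; apply/eqP.
by apply: (@ip_inj _ _ ip) => v; rewrite (orth v (A v))// -saA.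
Qed.

Let P z u := u + z *: A u.

Let Plin z : linear (P z).
Proof. by move=> c u v; rewrite /P linA !scalerDr !scalerA addrACA [z * c]mulrC. Qed.

Let PPE z u : z ^+ 2 = -1 -> P z (P (- z) u) = u + A (A u).
Proof.
move=> z2; rewrite /P (linear_funD linA) (linear_funZ linA) !scaleNr scalerDr scalerN.
by rewrite scalerA -expr2 z2 scaleN1r opprK addrA subrK.
Qed.

Let Padj z u v : ip (P z u) v = ip u (P z^* v).
Proof. by rewrite /P ipDl ipZl ipDr ipZr conjCK saA. Qed.

Let PC z z' u : P z (P z' u) = P z' (P z u).
Proof.
rewrite /P !(linear_funD linA) !(linear_funZ linA) !scalerDr !scalerA.
by rewrite [LHS]addrACA [z * z']mulrC.
Qed.

Let bP z : bounded_op (P z).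
Proof. exact: bounded_op_add bounded_op_id (bounded_op_scale z bA). Qed.

(* [b] is [(1 + A^2)^-1]; the unitary [(1 + iA)^2 b] is the Cayley transform
   [(1 + iA) (1 - iA)^-1], from which [A] is recovered. *)
Lemma commute_selfadjoint M K : von_neumann_algebra ip M -> commutant M A -> bounded_op K ->
  (forall U, commutant M U -> Defs.is_unitary ip U -> forall u, K (U u) = U (K u)) ->
  forall u, K (A u) = A (K u).
Proof.
move=> hM /commutantP[_ MA] [linK _] KU.
have /choice[b bE] := one_plus_sqr_surj.
have bK u : b (u + A (A u)) = u.
  apply/eqP; rewrite -subr_eq0; apply/eqP/one_plus_sqr_inj.
  by rewrite !(linear_funB linA) addrACA -opprD bE subrr.
have blin : linear b.
  move=> z u v; rewrite -[in LHS](bE u) -[in LHS](bE v).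
  by rewrite scalerDr addrACA -!linA bK.
have bcomm S : linear S -> (forall u, A (S u) = S (A u)) -> forall u, b (S u) = S (b u).
  by move=> linS AS u; rewrite -[in LHS](bE u) (linear_funD linS) -!AS bK.
(* Contractivity comes from [ip u (b u)] being the sum of the squared norms of [b u] and
   [A (b u)]. *)
have bbnd u : rnorm (b u) <= 1 * rnorm u.
  have [->|n0] := eqVneq (rnorm (b u)) 0; first by rewrite mul1r rnorm_ge0.
  have np : 0 < rnorm (b u) by rewrite lt_def n0 rnorm_ge0.
  rewrite mul1r -(ler_pM2r np) -expr2; apply: le_trans (Re_ip_le hip _ _).
  rewrite -[X in ip X _]bE (ipDl ip) saA raddfD/= -!(rnorm_sqr hip).
  by rewrite lerDl sqr_ge0.
have bb : bounded_op b := bound_bounded_op blin ler01 bbnd.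
have i2 : ('i%C : R[i]) ^+ 2 = -1 by rewrite sqr_i.
have cni : (- 'i%C : R[i])^* = 'i%C by rewrite rmorphN/= conjC_i opprK.
have APC z u : A (P z u) = P z (A u).
  by rewrite /P (linear_funD linA) (linear_funZ linA).
have bPC z u : b (P z u) = P z (b u) by apply: bcomm (Plin z) _ u => v; rewrite APC.
pose U u := P 'i%C (P 'i%C (b u)); pose V u := P (- 'i%C) (P (- 'i%C) (b u)).
have PP u : P 'i%C (P (- 'i%C) u) = u + A (A u) by exact: PPE.
have PN u : P (- 'i%C) (P 'i%C u) = u + A (A u) by rewrite PC PP.
have UV : U \o V = idfun.
  by apply/funext => u /=; rewrite /U /V !bPC [P 'i%C (P (- 'i%C) (P (- 'i%C) _))]PC !PP !bE.
have VU : V \o U = idfun.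
  by apply/funext => u /=; rewrite /U /V !bPC [P (- 'i%C) (P 'i%C (P 'i%C _))]PC !PN !bE.
have adjUV : is_adjoint ip U V.
  move=> u v; have uE : P 'i%C (P (- 'i%C) (b u)) = u by rewrite PP bE.
  have vE : P 'i%C (P (- 'i%C) (b v)) = v by rewrite PP bE.
  rewrite -[in LHS]vE -[in RHS]uE /U /V !Padj conjC_i cni.
  by rewrite [P (- 'i%C) (P 'i%C _)]PC [P (- 'i%C) (P 'i%C _)]PC.
(* [U] is a polynomial in [A] times [b], and both commute with [M]. *)
have MU : commutant M U.
  apply/commutantP; split.
    exact: bounded_op_comp (bP _) (bounded_op_comp (bP _) bb).
  move=> S MS; have linS := (vna_bounded hM MS).1.
  have PS z u : P z (S u) = S (P z u).
    by rewrite /P MA// (linear_funD linS) (linear_funZ linS).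
  by move=> u; rewrite /U bcomm// => [|v]; rewrite ?PS// MA.
have UuU : Defs.is_unitary ip U by exists V.
(* [U + 1 = 2 (1 - iA)^-1] *)
have rE u : P 'i%C (b u) = 2^-1 *: (U u + u).
  have uE : P 'i%C (P (- 'i%C) (b u)) = u by rewrite PP bE.
  rewrite -[X in U u + X]uE /U -(linear_funD (Plin _)) -(linear_funZ (Plin _)).
  congr (P _ _); rewrite /P scaleNr addrACA subrr addr0 scalerDr.
  by rewrite -scalerDl (_ : 2^-1 + 2^-1 = 1) ?scale1r//; field.
have Kr u : K (P 'i%C (b u)) = P 'i%C (b (K u)).
  by rewrite !rE (linear_funZ linK) (linear_funD linK) KU.
(* By [Kr], [K] commutes with the inverse of [P (- 'i%C)], hence with [P (- 'i%C)] itself, and so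
   with [A]. *)
have KP u : K (P (- 'i%C) u) = P (- 'i%C) (K u).
  have e v : P (- 'i%C) (P 'i%C (b v)) = v by rewrite PN bE.
  by rewrite -[LHS]e -Kr bPC PP bE.
move=> u; have := KP u; rewrite /P (linear_funD linK) (linear_funZ linK).
by move/addrI/scalerI; apply; rewrite oppr_eq0 complexiE neq0Ci.
Qed.

End SelfAdjoint.
End UnitarySpan.

(** * Membership in [M] through the bicommutant, and the operator [K] attached to [x] *)

Section Bicommutant.
Context {R : realType} {H : completeNormedModType R[i]}.
Variable ip : {dot H for (@conjC R[i])}.
Hypothesis hip : is_inner_product ip.
Variable M : set (H -> H).
Hypothesis hM : von_neumann_algebra ip M.
Local Notation "x %:C" := (real_complex R x) (format "x %:C") : ring_scope.
Implicit Types (S T K U : H -> H).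

Lemma commutant_add S T : commutant M S -> commutant M T -> commutant M (S \+ T).
Proof.
move=> /commutantP[bS MS] /commutantP[bT MT]; apply/commutantP.
split; first exact: bounded_op_add.
by move=> W MW u /=; rewrite MS// MT// (linear_funD (vna_bounded hM MW).1).
Qed.

Lemma commutant_scale z S : commutant M S -> commutant M (z \*: S).
Proof.
move=> /commutantP[bS MS]; apply/commutantP; split; first exact: bounded_op_scale.
by move=> W MW u /=; rewrite MS// (linear_funZ (vna_bounded hM MW).1).
Qed.

Lemma commutant_adjoint S T : commutant M S -> is_adjoint ip S T -> commutant M T.
Proof.
move=> /commutantP[bS MS] ST; apply/commutantP.
split; first exact: (adjoint_bounded hip bS ST).
move=> W MW u; have [W' MW' WW'] := vna_adjoint hM MW.
have W'W := adjoint_sym WW'.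
by apply: (@ip_injr _ _ ip) => v; rewrite -ST -!W'W -ST MS.
Qed.

(** By the bicommutant property, [K] has to commute with each [T] in the commutant. With [T'] the
    adjoint of [T], the operators [T + T'] and [i (T - T')] are self-adjoint elements of the
    commutant, so [commute_selfadjoint] handles both, and they determine [T]. *)
Lemma vna_of_commute_unitaries K : bounded_op K ->
  (forall U, commutant M U -> Defs.is_unitary ip U -> forall u, K (U u) = U (K u)) ->
  M K.
Proof.
move=> bK KU; have linK := bK.1.
rewrite -(vna_bicommutant hM); apply/commutantP; split => // T MT u.
have [bT _] := (commutantP M T).1 MT.
have [T' TT'] := adjoint_exists hip bT; have T'T := adjoint_sym TT'.
have MT' := commutant_adjoint MT TT'.
have sa A : commutant M A -> is_adjoint ip A A -> K (A u) = A (K u).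
  move=> MA saA; have [bA _] := (commutantP M A).1 MA.
  exact: (commute_selfadjoint hip bA saA hM MA bK KU).
have h1 : K (T u) + K (T' u) = T (K u) + T' (K u).
  rewrite -(linear_funD linK); apply: (sa (T \+ T')); first exact: commutant_add.
  by move=> v w /=; rewrite ipDl ipDr TT' T'T addrC.
pose N := ('i%C : R[i]) \*: (T \+ (-1) \*: T').
have h2 : K (T u) - K (T' u) = T (K u) - T' (K u).
  have : K (N u) = N (K u).
    apply: sa; first by do ?[apply: commutant_scale|apply: commutant_add].
    move=> v w /=; rewrite ipZl ipZr !ipDl !ipDr !ipZl !ipZr TT' T'T conjC_i rmorphN1.
    ring.
  rewrite /N/= (linear_funZ linK) (linear_funD linK) (linear_funZ linK) !scaleN1r.
  by move/scalerI; apply; rewrite complexiE neq0Ci.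
apply: (@scalerI _ _ (2 : R[i])); first by rewrite pnatr_eq0.
rewrite !scaler_nat !mulr2n; have := congr2 +%R h1 h2.
by rewrite [LHS]addrACA subrr addr0 [RHS]addrACA subrr addr0.
Qed.

Lemma affiliated_symmetric x U V u v : affiliated ip M x ->
  commutant M U -> Defs.is_unitary ip U -> U \o V = idfun ->
  x (u, v) -> x (V u, V v).
Proof.
move=> affx MU uU UV xuv; apply: (affx U MU uU _ _).2.
by rewrite -[U (V u)]/((U \o V) u) -[U (V v)]/((U \o V) v) UV.
Qed.

(* [K = 1 - (1 + x^* x)^-1], where [(1 + x^* x)^-1 u] is the first component of
   the orthogonal projection of [(u, 0)] onto the graph of [x]. *)
Lemma damped_square_exists (x : set (H * H)) :
  closed_operator x -> affiliated ip M x ->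
  exists K, [/\ M K, positive_op ip K,
    forall w s, x (w, s) -> complex.Re (ip (K w) w) <= rnorm s ^+ 2 &
    (forall u, K u = 0) -> x = graph (\0 : H -> H)].
Proof.
move=> [[x0 xlin xfun] xcl] affx.
have /choice[g gP] (u : H) : exists g : H * H, x g /\
    forall w' s', x (w', s') -> ip (u - g.1) w' = ip g.2 s'.
  by have [w [s ws]] := graph_projection hip x0 xlin xcl u; exists (w, s).
(* Uniqueness of the projection: the linearity of [g] and its compatibility with unitaries both
   follow by exhibiting a candidate. *)
have gU u w s : x (w, s) -> (forall w' s', x (w', s') -> ip (u - w) w' = ip s s') ->
    g u = (w, s).
  move=> xws orth; have [xg orthg] := gP u.
  have xd : x (w - (g u).1, s - (g u).2).
    rewrite [g u]surjective_pairing in xg.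
    have := xlin (-1) _ _ _ _ xg xws.
    by rewrite !scaleN1r addrC [- (g u).2 + s]addrC.
  have h1 := orth _ _ xd; have h2 := orthg _ _ xd.
  have : rnorm (w - (g u).1) ^+ 2 + rnorm (s - (g u).2) ^+ 2 = 0.
    rewrite !(rnorm_sqr hip) -raddfD/= [X in ip X _ + _](_ : _ = (u - (g u).1) - (u - w)).
      by rewrite (ipBl ip) h1 h2 -(ipBl ip) -(ipDl ip) subrKA subrr (ip0l ip).
    by rewrite opprB [RHS]addrC subrKA.
  move/eqP; rewrite paddr_eq0 ?sqr_ge0// !sqrf_eq0 => /andP[/eqP/rnorm_eq0 e1 /eqP/rnorm_eq0 e2].
  by rewrite [g u]surjective_pairing; congr pair; apply/esym/eqP; rewrite -subr_eq0 ?e1 ?e2.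
pose K u := u - (g u).1.
have glin z u v : g (z *: u + v) = (z *: (g u).1 + (g v).1, z *: (g u).2 + (g v).2).
  apply: gU => [|w' s' x'].
    by apply: xlin; rewrite -surjective_pairing; exact: (gP _).1.
  have [[_ ou] [_ ov]] := (gP u, gP v).
  rewrite opprD addrACA -scalerBr (ipDl ip) (ipZl ip) (ou _ _ x') (ov _ _ x').
  by rewrite (ipDl ip) (ipZl ip).
have linK : linear K.
  by move=> z u v; rewrite /K glin/= opprD addrACA -scalerBr.
have gg u : ip (K u) (g u).1 = (rnorm (g u).2 ^+ 2)%:C.
  have [xg og] := gP u; rewrite [X in x X]surjective_pairing in xg.
  by rewrite /K (og _ _ xg) (ip_norm hip).
(* This identity gives at once the positivity of [K], its contractivity, and the last claim. *)
have Kuu u : ip (K u) u = (rnorm (K u) ^+ 2 + rnorm (g u).2 ^+ 2)%:C.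
  rewrite rmorphD/= -gg -(ip_norm hip) -(ipDr ip).
  by rewrite {3}/K subrK.
have bK : bounded_op K.
  apply: (bound_bounded_op linK ler01) => u; rewrite mul1r.
  have [->|n0] := eqVneq (rnorm (K u)) 0; first exact: rnorm_ge0.
  have np : 0 < rnorm (K u) by rewrite lt_def n0 rnorm_ge0.
  rewrite -(ler_pM2l np) -expr2; apply: le_trans (Re_ip_le hip _ _).
  by rewrite Kuu/= lerDl sqr_ge0.
exists K; split.
- apply: vna_of_commute_unitaries => // U MU uU u; have [V [UaV UV VU]] := uU.
  have [bU _] := (commutantP M U).1 MU; have linU := bU.1.
  rewrite /K (linear_funB linU); congr (_ - _).
  (* A unitary of the commutant preserves [x] and the inner product, so it carries the projection of
     [(u, 0)] to that of [(U u, 0)]. *)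
  rewrite (gU (U u) (U (g u).1) (U (g u).2))//.
    by apply: (affx U MU uU _ _).1; rewrite -surjective_pairing; exact: (gP u).1.
  move=> w' s' x'; rewrite -(linear_funB linU) !UaV; apply: (gP u).2.
  exact: affiliated_symmetric affx MU uU UV x'.
- by move=> u; rewrite Kuu ler0c addr_ge0// sqr_ge0.
- move=> w s xws; have := (gP w).2 _ _ xws; rewrite -/(K w) => Kws.
  have := Kuu w; rewrite Kws => /(congr1 (@complex.Re R))/= e.
  have := Re_ip_le hip (g w).2 s; rewrite e => h.
  (* Here [ip (K w) w = ip (g w).2 s], and it dominates the square of [rnorm (g w).2]; hence
     [rnorm (g w).2 <= rnorm s], which is fed back into Cauchy-Schwarz. *)
  have h' : rnorm (g w).2 ^+ 2 <= rnorm (g w).2 * rnorm s.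
    by apply: le_trans h; rewrite lerDr sqr_ge0.
  have [gw0|gw0] := eqVneq (rnorm (g w).2) 0.
    by rewrite -e; apply: le_trans (Re_ip_le hip _ _) _; rewrite gw0 mul0r sqr_ge0.
  rewrite -e; apply: le_trans (Re_ip_le hip _ _) _; rewrite expr2 ler_wpM2r ?rnorm_ge0//.
  by move: h'; rewrite expr2 ler_pM2l// lt_def gw0 rnorm_ge0.
- move=> K0; have xu0 u : x (u, 0).
    have := Kuu u; rewrite K0 (ip0l ip) rnorm0 expr0n/= add0r => /(congr1 (@complex.Re R))/=.
    move/esym/eqP; rewrite sqrf_eq0 => /eqP/rnorm_eq0 e.
    have := (gP u).1; rewrite [g u]surjective_pairing e.
    by have /eqP := K0 u; rewrite subr_eq0 => /eqP <-.
  apply/seteqP; split => -[u v]; rewrite /graph/=; first by move=> /xfun; apply.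
  by move=> ->.
Qed.

End Bicommutant.

(** * Operator inequalities and the trace *)

Section Trace.
Context {R : realType} {H : completeNormedModType R[i]}.
Variable ip : {dot H for (@conjC R[i])}.
Hypothesis hip : is_inner_product ip.
Variable M : set (H -> H).
Hypothesis hM : von_neumann_algebra ip M.
Variable tau : (H -> H) -> \bar R.
Hypothesis htau : nsf_trace ip M tau.
Local Notation "x %:C" := (real_complex R x) (format "x %:C") : ring_scope.
Implicit Types (S T p q : H -> H).

Lemma vna_sub S T : M S -> M T -> M (S \- T).
Proof.
move=> MS MT; rewrite (_ : S \- T = S \+ (-1) \*: T).
  by apply: (vna_add hM) => //; apply: (vna_scale hM).
by apply/funext => u /=; rewrite scaleN1r.
Qed.

Lemma vna_zero : M (\0 : H -> H).
Proof.
rewrite (_ : \0 = idfun \- idfun); first by apply: vna_sub; exact: (vna_one hM).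
by apply/funext => u /=; rewrite subrr.
Qed.

Lemma positive_opE S u : positive_op ip S ->
  ip (S u) u = (complex.Re (ip (S u) u))%:C.
Proof. by move=> /(_ u) S0; rewrite RRe_real// ger0_real. Qed.

Lemma positive_op_Re_ge0 S u : positive_op ip S -> 0 <= complex.Re (ip (S u) u).
Proof. by move=> S0; rewrite -ler0c -positive_opE. Qed.

Lemma le_op_Re S T : positive_op ip S -> positive_op ip T ->
  (forall u, complex.Re (ip (S u) u) <= complex.Re (ip (T u) u)) -> le_op ip S T.
Proof.
move=> S0 T0 ST u /=.
by rewrite (ipBl ip) (positive_opE _ S0) (positive_opE _ T0) -rmorphB ler0c subr_ge0.
Qed.

Lemma pos_cone_square S T : M S -> M T -> is_adjoint ip S T ->
  pos_cone ip M (T \o S) /\ forall u, complex.Re (ip (T (S u)) u) = rnorm (S u) ^+ 2.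
Proof.
move=> MS MT ST; have e u : ip (T (S u)) u = (rnorm (S u) ^+ 2)%:C.
  by rewrite (adjoint_sym ST) (ip_norm hip).
split=> [|u]; last by rewrite e.
split; first exact: (vna_mul hM).
by move=> u; rewrite /= e ler0c sqr_ge0.
Qed.

Lemma pos_cone_scale (c : R) S : 0 <= c -> pos_cone ip M S -> pos_cone ip M (c%:C \*: S).
Proof.
move=> c0 [MS S0]; split; first exact: (vna_scale hM).
by move=> u /=; rewrite (ipZl ip) mulr_ge0// ler0c.
Qed.

Lemma pos_cone_zero : pos_cone ip M (\0 : H -> H).
Proof. by split; [exact: vna_zero|move=> u /=; rewrite (ip0l ip)]. Qed.

Lemma trace_zero : tau \0 = 0%E.
Proof.
rewrite [X in tau X](_ : _ = (0%:C \*: \0 : H -> H)).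
  by rewrite (trace_scale htau)// ?mul0e//; exact: pos_cone_zero.
by apply/funext => u /=; rewrite scaler0.
Qed.

Lemma trace_le S T : pos_cone ip M S -> pos_cone ip M T -> le_op ip S T ->
  (tau S <= tau T)%E.
Proof.
move=> cS cT ST; have cD : pos_cone ip M (T \- S).
  by split => //; apply: vna_sub; [exact: cT.1|exact: cS.1].
rewrite [X in (_ <= tau X)%E](_ : _ = S \+ (T \- S)).
  by rewrite (trace_add htau)// leeDl// (trace_ge0 htau).
by apply/funext => u /=; rewrite addrC subrK.
Qed.

Lemma projection_idem p u : is_projection ip p -> p (p u) = p u.
Proof. by case=> /(congr1 (fun f => f u)). Qed.

Lemma projection_Re p u : is_projection ip p ->
  complex.Re (ip (p u) u) = rnorm (p u) ^+ 2.
Proof.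
by move=> pp; rewrite (rnorm_sqr hip) -[in LHS](projection_idem _ pp) (pp.2).
Qed.

Lemma projections_pos p : projections ip M p -> pos_cone ip M p.
Proof.
move=> [Mp pp]; split => // u.
by rewrite -(projection_idem _ pp) (pp.2) (ip_norm hip) ler0c sqr_ge0.
Qed.

Lemma projections_id : projections ip M idfun.
Proof. by split; [exact: (vna_one hM)|split]. Qed.

Lemma projections_compl p : projections ip M p -> projections ip M (idfun \- p).
Proof.
move=> [Mp pp]; have linp := (vna_bounded hM Mp).1.
split; first by apply: vna_sub => //; exact: (vna_one hM).
split; first by apply/funext => u /=; rewrite (linear_funB linp) (projection_idem _ pp) subrr subr0.
by move=> u v /=; rewrite (ipBl ip) (ipBr ip) (pp.2).
Qed.

Lemma pythagoras p u : projections ip M p ->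
  rnorm u ^+ 2 = rnorm (p u) ^+ 2 + rnorm (u - p u) ^+ 2.
Proof.
move=> pp; have [_ pq] := projections_compl pp.
rewrite -(projection_Re _ pp.2) -[u - p u]/((idfun \- p) u) -(projection_Re _ pq).
by rewrite -raddfD/= -(ipDl ip) addrC subrK (rnorm_sqr hip).
Qed.

Lemma projection_le p u : projections ip M p -> rnorm (p u) <= rnorm u.
Proof.
move=> pp; apply: rnorm_le; first exact: rnorm_ge0.
by rewrite [leRHS](pythagoras u pp) lerDl sqr_ge0.
Qed.

(** With [r = 1 - p], the hypothesis at [q u] and Pythagoras give [q <= 2 q r q]. Traciality
    exchanges [q r q] for [r q r], which is at most [r]. *)
Lemma trace_projection_le p q : projections ip M p -> projections ip M q ->
  (forall u, rnorm (q (p u)) <= 2^-1 * rnorm u) ->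
  (tau q <= 2%:E * tau (idfun \- p)%R)%E.
Proof.
move=> pp qq qp; have rr := projections_compl pp; set r := idfun \- p in rr *.
have [[Mp pP] [Mq qP] [Mr rP]] := And3 pp qq rr.
have adj : is_adjoint ip (r \o q) (q \o r).
  by move=> u v /=; rewrite rP.2 qP.2.
have [c1 e1] := pos_cone_square (vna_mul hM Mr Mq) (vna_mul hM Mq Mr) adj.
have [c2 e2] := pos_cone_square (vna_mul hM Mq Mr) (vna_mul hM Mr Mq) (adjoint_sym adj).
apply: (@le_trans _ _ (tau (2%:C \*: ((q \o r) \o (r \o q))))).
  apply: trace_le => //; [exact: projections_pos|exact: pos_cone_scale|].
  apply: le_op_Re => [||u]; [exact: (projections_pos qq).2| |].
    exact: (pos_cone_scale _ c1).2.
  rewrite (projection_Re _ qP) /= (ipZl ip).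
  rewrite [X in complex.Re (_ * X)](positive_opE _ c1.2) -rmorphM/= e1 /=.
  have := pythagoras (q u) pp; rewrite -[q u - p (q u)]/(r (q u)) => ->.
  have h : rnorm (p (q u)) ^+ 2 <= 2^-1 * rnorm (q u) ^+ 2.
    rewrite -(projection_Re _ pP) -[X in ip _ X](projection_idem _ qP) -qP.2.
    apply: le_trans (Re_ip_le hip _ _) _.
    by rewrite expr2 mulrA ler_wpM2r ?rnorm_ge0.
  by have := pythagoras (q u) pp; rewrite -[q u - p (q u)]/(r (q u)); lra.
rewrite (trace_scale htau)// (trace_tracial htau (vna_mul hM Mr Mq) (vna_mul hM Mq Mr) adj).
rewrite lee_pmul2l//; apply: trace_le => //; first exact: projections_pos.
apply: le_op_Re => [||u]; [exact: c2.2|exact: (projections_pos rr).2|].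
rewrite [leLHS]e2 (projection_Re _ rP) ler_sqr ?nnegrE ?rnorm_ge0//.
exact: (projection_le (r u) qq).
Qed.

(** Polarization: the vectors [u + v] and [u + i v] give the sum and the difference of [ip (S u) v]
    and [ip (S v) u]. *)
Lemma linear_eq0 S : linear S -> (forall u, ip (S u) u = 0) -> forall u, S u = 0.
Proof.
move=> linS S0 u; apply: (@ip_inj _ _ ip) => v; rewrite (ip0l ip).
have := S0 (u + v); rewrite (linear_funD linS) (ipDl ip) !(ipDr ip) !S0 add0r addr0.
move=> h1; have := S0 (u + 'i%C *: v).
rewrite (linear_funD linS) (linear_funZ linS) (ipDl ip) !(ipDr ip) !(ipZl ip).
rewrite !(ipZr ip) !S0 !mulr0 add0r addr0 conjC_i mulNr addrC -mulrBr => /eqP.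
rewrite mulf_eq0 complexiE (negPf (neq0Ci _)) orFb subr_eq0 => /eqP h2.
by move: h1; rewrite h2 => /eqP; rewrite -mulr2n mulrn_eq0 => /eqP.
Qed.

(** Since [ip (T w) w] is real, the quadratic form of [T] minus its adjoint vanishes, and
    [linear_eq0] applies. *)
Lemma positive_selfadjoint T : M T -> positive_op ip T -> is_adjoint ip T T.
Proof.
move=> MT T0; have [T' MT' TT'] := vna_adjoint hM MT.
have linT := (vna_bounded hM MT).1; have linT' := (vna_bounded hM MT').1.
have linD : linear (fun u => T u - T' u).
  by move=> z u v; rewrite linT linT' scalerBr opprD addrACA.
move=> u v; rewrite TT'; congr (ip _ _); apply/esym/eqP; rewrite -subr_eq0; apply/eqP.
apply: (linear_eq0 linD) => w.
by rewrite (ipBl ip) (adjoint_sym TT') (ipC ip w) (conj_Creal (ger0_real (T0 w))) subrr.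
Qed.

(** This is [T p T <= e^2 T]. Cauchy-Schwarz for the form of [T], at [u] and [p v] with
    [v = p (T u)], bounds the fourth power of [rnorm v]; one factor [rnorm v ^+ 2] then cancels. *)
Lemma semidefinite_operator_bound T p (e : R) u : pos_cone ip M T -> projections ip M p ->
  (forall w, complex.Re (ip (T (p w)) (p w)) <= e ^+ 2 * rnorm w ^+ 2) ->
  rnorm (p (T u)) ^+ 2 <= e ^+ 2 * complex.Re (ip (T u) u).
Proof.
move=> [MT T0] [Mp pP] Tp; have saT := positive_selfadjoint MT T0.
have linT := (vna_bounded hM MT).1.
set v := p (T u); have [->|v0] := eqVneq (rnorm v) 0.
  by rewrite expr0n/= mulr_ge0 ?sqr_ge0// positive_op_Re_ge0.
have vp : 0 < rnorm v ^+ 2 by rewrite exprn_gt0// lt_def v0 rnorm_ge0.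
have := @semidefinite_cauchy_schwarz _ _ (fun x y => ip (T x) y) _ _ _ T0 u (p v).
move=> /(_ _ _ _) h; have {h} : `|(rnorm v ^+ 2)%:C| ^+ 2 <=
    (complex.Re (ip (T u) u) * complex.Re (ip (T (p v)) (p v)))%:C.
  move: h; rewrite -(pP.2 (T u) v) -/v (ip_norm hip) (positive_opE u T0).
  rewrite (positive_opE (p v) T0) -rmorphM; apply => [a b c|z a b|a b].
  - by rewrite (linear_funB linT) (ipBl ip).
  - by rewrite (linear_funZ linT) (ipZl ip).
  - by rewrite saT -ipC.
rewrite ger0_norm ?ler0c ?sqr_ge0// -rmorphXn lecR => h.
rewrite -(ler_pM2r vp) -expr2; apply: le_trans h _.
by rewrite -mulrA mulrCA ler_wpM2l ?positive_op_Re_ge0.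
Qed.

Lemma trace_square_le T p (e c : R) : pos_cone ip M T -> projections ip M p ->
  (forall w, complex.Re (ip (T (p w)) (p w)) <= e ^+ 2 * rnorm w ^+ 2) ->
  (forall w, rnorm (T w) <= c * rnorm w) ->
  (tau (T \o T) <= (e ^+ 2)%:E * tau T + (c ^+ 2)%:E * tau (idfun \- p)%R)%E.
Proof.
move=> cT pp Tp Tc; have rr := projections_compl pp; set r := (idfun \- p)%R in rr *.
have [[MT T0] [Mp pP] [Mr rP]] := And3 cT pp rr.
have saT := positive_selfadjoint MT T0; have linT := (vna_bounded hM MT).1.
have adjp : is_adjoint ip (p \o T) (T \o p) by move=> u v /=; rewrite pP.2 saT.
have adjr : is_adjoint ip (r \o T) (T \o r) by move=> u v /=; rewrite rP.2 saT.
have [c1 e1] := pos_cone_square (vna_mul hM Mp MT) (vna_mul hM MT Mp) adjp.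
have [c2 e2] := pos_cone_square (vna_mul hM Mr MT) (vna_mul hM MT Mr) adjr.
have [c3 e3] := pos_cone_square (vna_mul hM MT Mr) (vna_mul hM Mr MT) (adjoint_sym adjr).
(* Writing [p] and [r] twice makes each summand an adjoint composed with its operator; traciality is
   applied only to the second one, to reach [r T T r]. *)
have -> : T \o T = ((T \o p) \o (p \o T)) \+ ((T \o r) \o (r \o T)).
  apply/funext => u /=; rewrite (projection_idem _ pP) (projection_idem _ rP).
  by rewrite -(linear_funD linT) /r/= addrC subrK.
rewrite (trace_add htau)//; apply: leeD.
  rewrite -(trace_scale htau) ?sqr_ge0//; apply: trace_le => //.
    by apply: pos_cone_scale => //; exact: sqr_ge0.
  apply: le_op_Re => [||u]; [exact: c1.2|exact: (pos_cone_scale (sqr_ge0 e) cT).2|].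
  rewrite [leLHS]e1 /= (ipZl ip) (positive_opE _ T0) -rmorphM/=.
  exact: semidefinite_operator_bound.
rewrite (trace_tracial htau (vna_mul hM Mr MT) (vna_mul hM MT Mr) adjr).
rewrite -(trace_scale htau) ?sqr_ge0//; last exact: projections_pos.
have cr := pos_cone_scale (sqr_ge0 c) (projections_pos rr).
apply: trace_le => //; apply: le_op_Re => [||u]; [exact: c3.2|exact: cr.2|].
rewrite [leLHS]e3 /= (ipZl ip) (positive_opE _ (projections_pos rr).2) -rmorphM/=.
rewrite (projection_Re _ rP) -exprMn ler_sqr ?nnegrE ?rnorm_ge0//.
by rewrite (le_trans _ (Tc _))// rnorm_ge0.
Qed.

Lemma trace_square_eq0 T : pos_cone ip M T -> tau (T \o T) = 0%E -> T = \0.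
Proof.
move=> cT; have saT := positive_selfadjoint cT.1 cT.2.
have [c1 e1] := pos_cone_square cT.1 cT.1 saT.
move=> /(trace_faithful htau c1) TT; apply/funext => u; apply: rnorm_eq0.
apply/eqP; rewrite -sqrf_eq0 -e1 -[T (T u)]/((T \o T) u) TT /=.
by rewrite (ip0l ip).
Qed.

End Trace.

(** * The sum of a closed operator and a bounded one *)

Section StrongSum.
Context {R : realType} {H : completeNormedModType R[i]}.
Variable ip : {dot H for (@conjC R[i])}.
Variable M : set (H -> H).
Variables (y : set (H * H)) (z : H -> H).
Hypotheses (cly : closed_operator y) (bz : bounded_op z).

(** The algebraic sum is the preimage of the closed set [y] under a continuous shear, so taking the
    closure adds nothing. *)
Lemma strong_sumE : strong_sum y (graph z) = [set w | y (w.1, w.2 - z w.1)].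
Proof.
have e : add_op y (graph z) = (fun w : H * H => (w.1, w.2 - z w.1)) @^-1` y.
  apply/seteqP; split => -[u v] /=; rewrite /add_op/graph/=.
    by move=> [v1 [v2 [yv1 -> ->]]]; rewrite addrK.
  by move=> yv; exists (v - z u), (z u); split => //; rewrite subrK.
rewrite /strong_sum -[RHS]e; apply: esym; apply/closure_id; rewrite e.
apply: closed_comp; last exact: cly.2.
by move=> w _; exact: (shear_continuous bz.2).
Qed.

Lemma strong_sum_closed : closed_operator (strong_sum y (graph z)).
Proof.
split; last exact: closed_closure.
rewrite strong_sumE; have [[y0 ylin yfun] _] := cly; have linz := bz.1.
split => [|c u v u' v'|u v v'] /=.
- by rewrite (linear_fun0 linz) subr0.
- move=> yv yv'; rewrite linz opprD addrACA -scalerBr; exact: ylin.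
- by move=> h /(yfun _ _ _ h) /addIr.
Qed.

Lemma strong_sum_affiliated : M z -> affiliated ip M y ->
  affiliated ip M (strong_sum y (graph z)).
Proof.
move=> Mz affy U MU uU u v; rewrite strong_sumE /=.
have [bU cU] := (commutantP M U).1 MU.
by rewrite -cU// -(linear_funB bU.1); exact: affy.
Qed.

End StrongSum.

(** * Singular values of projections, of sums, and their positivity near 0 *)

Section SingularValues.
Context {R : realType} {H : completeNormedModType R[i]}.
Variable ip : {dot H for (@conjC R[i])}.
Hypothesis hip : is_inner_product ip.
Variable M : set (H -> H).
Hypothesis hM : von_neumann_algebra ip M.
Variable tau : (H -> H) -> \bar R.
Hypothesis htau : nsf_trace ip M tau.
Local Notation "x %:C" := (real_complex R x) (format "x %:C") : ring_scope.
Implicit Types (p q : H -> H) (a x y : set (H * H)) (t s c : R).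
Local Notation mu := (mu ip M tau).

Lemma opnorm_ge0 a : (0 <= opnorm a)%E.
Proof. by apply: le_ereal_inf_tmp => _ [c [c0 _] <-]; rewrite lee_fin. Qed.

Lemma opnorm_le a c : 0 <= c ->
  (forall u, exists2 v, a (u, v) & rnorm v <= c * rnorm u) -> (opnorm a <= c%:E)%E.
Proof.
move=> c0 ac; apply: ereal_inf_lbound; exists c => //; split => // u.
by have [v av vc] := ac u; exists v => //; rewrite !normE -rmorphM lecR.
Qed.

Lemma opnorm_lt a (c : \bar R) : (opnorm a < c)%E ->
  exists2 c', (0 <= c' /\ (c'%:E < c)%E) &
    forall u, exists2 v, a (u, v) & rnorm v <= c' * rnorm u.
Proof.
move=> /ereal_inf_lt[_ [c' [c'0 ac] <-] c'c]; exists c' => // u.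
by have [v av] := ac u; rewrite !normE -rmorphM lecR; exists v.
Qed.

Lemma mu_ge0 t a : (0 <= mu t a)%E.
Proof. by apply: le_ereal_inf_tmp => _ [p _ <-]; exact: opnorm_ge0. Qed.

Lemma mu_le t a p : projections ip M p -> (tau (idfun \- p)%R <= t%:E)%E ->
  (mu t a <= opnorm (comp_op a p))%E.
Proof. by move=> pp tp; apply: ereal_inf_lbound; exists p. Qed.

Lemma mu_lt t a (c : \bar R) : (mu t a < c)%E ->
  exists2 p, projections ip M p /\ (tau (idfun \- p)%R <= t%:E)%E &
    exists2 c', (0 <= c' /\ (c'%:E < c)%E) &
      forall u, exists2 v, a (p u, v) & rnorm v <= c' * rnorm u.
Proof.
by move=> /ereal_inf_lt[_ [p pp <-]] /opnorm_lt[c' c'0 ac]; exists p => //; exists c'.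
Qed.

Lemma mu_nonincreasing a s t : s <= t -> (mu t a <= mu s a)%E.
Proof.
move=> st; apply: le_ereal_inf_tmp => _ [p [pp ps] <-]; apply: mu_le => //.
by rewrite (le_trans ps)// lee_fin.
Qed.

Lemma mu_projection_le1 t q : 0 <= t -> projections ip M q -> (mu t (graph q) <= 1)%E.
Proof.
move=> t0 qq; apply: le_trans (@mu_le _ _ idfun (projections_id hM) _) _.
  rewrite (_ : (idfun \- idfun)%R = \0 :> (H -> H)); last by apply/funext => u /=; rewrite subrr.
  by rewrite (trace_zero hM htau) lee_fin.
apply: opnorm_le => // u; exists (q u) => //.
by rewrite mul1r; exact: (projection_le hip hM).
Qed.

(** The competitor is [1 - q]: its complement is [q], and [q (1 - q) = 0]. *)
Lemma mu_projection_eq0 t q : projections ip M q -> (tau q <= t%:E)%E ->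
  mu t (graph q) = 0%E.
Proof.
move=> qq tq; apply/eqP; rewrite eq_le mu_ge0 andbT.
apply: le_trans (@mu_le _ _ (idfun \- q)%R (projections_compl hM qq) _) _.
  rewrite (_ : (idfun \- (idfun \- q))%R = q)//.
  by apply/funext => u /=; rewrite subKr.
apply: opnorm_le => // u; exists 0; last by rewrite rnorm0 mul0r.
rewrite /comp_op/graph/= (linear_funB (vna_bounded hM qq.1).1).
by rewrite (projection_idem _ qq.2) subrr.
Qed.

(** A competitor [p] with the norm of [q p] below one half would give [tau q <= 2 t] by
    [trace_projection_le]. *)
Lemma mu_projection_ge t q : projections ip M q -> ((2 * t)%:E < tau q)%E ->
  ((2^-1)%:E <= mu t (graph q))%E.
Proof.
move=> qq tq; rewrite leNgt; apply/negP => /mu_lt[p [pp pt] [c [c0 c2] qp]].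
have : (tau q <= 2%:E * tau (idfun \- p)%R)%E.
  apply: (trace_projection_le hip hM htau) => // u.
  have [v + vc] := qp u; rewrite /graph/= => vE; rewrite -vE; apply: le_trans vc _.
  by rewrite ler_wpM2r ?rnorm_ge0// ltW.
rewrite leNgt => /negP; apply; apply: le_lt_trans tq.
by rewrite EFinM lee_pmul2l.
Qed.

(** A nearly optimal projection for [y] also competes for the sum, where [z] costs at most [c]. *)
Lemma mu_strong_sum_le t y z c : 0 <= c -> (forall u, rnorm (z u) <= c * rnorm u) ->
  (mu t (strong_sum y (graph z)) <= mu t y + c%:E)%E.
Proof.
move=> c0 zc; apply/lee_addgt0Pr => e e0.
have := mu_ge0 t y; case E : (mu t y) => [m| |//] => [|_]; last by rewrite !addye// leey.
rewrite lee_fin => m0.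
have : (mu t y < (m + e)%:E)%E by rewrite E lte_fin ltrDl.
move=> /mu_lt[p [pp pt] [c' [c'0 c'm] yp]].
apply: le_trans (mu_le _ pp pt) _; rewrite -!EFinD.
have cc0 : 0 <= c' + c by rewrite addr_ge0.
apply: (@le_trans _ _ (c' + c)%:E); last by rewrite lee_fin; move: c'm; rewrite lte_fin; lra.
apply: opnorm_le => // u; have [v yv vc] := yp u.
exists (v + z (p u)).
  by apply: subset_closure; exists v, (z (p u)).
apply: le_trans (rnormD _ _) _; rewrite mulrDl lerD// (le_trans (zc _))//.
by rewrite ler_wpM2l// (projection_le hip hM).
Qed.

(** Otherwise [trace_square_le] could be applied with arbitrarily small errors to a nonzero [T] of
    finite trace below the operator [K] of [damped_square_exists], forcing [tau (T \o T) = 0]. *)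
Lemma mu_gt0 x : closed_operator x -> affiliated ip M x -> x <> graph (\0 : H -> H) ->
  exists2 t, 0 < t & (0 < mu t x)%E.
Proof.
move=> clx affx xn0; apply: contrapT => hmu; apply: xn0.
have {}hmu t : 0 < t -> mu t x = 0%E.
  move=> t0; apply/eqP; rewrite eq_le mu_ge0 andbT leNgt; apply/negP => h.
  by apply: hmu; exists t.
have [K [MK K0 Kx Kz]] := damped_square_exists hip hM clx affx.
apply: Kz; apply: contrapT => Kn0.
have {}Kn0 : K <> \0 by move=> K00; apply: Kn0 => u; rewrite K00.
have [T [cT Tn0 TK tT]] := trace_semifinite htau (conj MK K0) Kn0.
apply: Tn0; apply: (trace_square_eq0 hip hM htau cT).
have [c c0 Tc] := bounded_op_bound (vna_bounded hM cT.1).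
have cTT := (pos_cone_square hip hM cT.1 cT.1 (positive_selfadjoint hM cT.1 cT.2)).1.
apply/eqP; rewrite eq_le (trace_ge0 htau cTT) andbT.
have := trace_ge0 htau cT; case E : (tau T) tT => [m| |] // _; rewrite lee_fin => m0.
apply/lee_addgt0Pr => e e0; rewrite add0e.
(* The final bound is [c'^2 m + c^2 d]. From [c' < d <= 1] follows [c'^2 <= d], so it is at most
   [d C <= e]; the summand 1 keeps [C] positive. *)
pose C := m + c ^+ 2 + 1; have C0 : 0 < C by rewrite ltr_wpDl// addr_ge0// sqr_ge0.
pose d := Num.min 1 (e / C); have d0 : 0 < d by rewrite lt_min ltr01 divr_gt0.
have : (mu d x < d%:E)%E by rewrite hmu.
move=> /mu_lt[p [pp pd] [c' [c'0 c'd] xp]]; rewrite lte_fin in c'd.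
apply: le_trans (@trace_square_le _ _ _ hip _ hM _ htau T p c' c cT pp _ Tc) _.
  move=> w; have [s xs sc] := xp w.
  apply: (@le_trans _ _ (complex.Re (ip (K (p w)) (p w)))).
    have := TK (p w); rewrite /= (ipBl ip) subr_ge0 => h.
    by rewrite -lecR -(positive_opE _ K0) -(positive_opE _ cT.2).
  apply: le_trans (Kx _ _ xs) _; rewrite -exprMn ler_sqr ?nnegrE ?rnorm_ge0//.
  by rewrite mulr_ge0// rnorm_ge0.
apply: (@le_trans _ _ ((c' ^+ 2)%:E * m%:E + (c ^+ 2)%:E * d%:E)%E).
  by rewrite E leeD2l// lee_wpmul2l// lee_fin sqr_ge0.
rewrite -!EFinM -EFinD lee_fin.
have d1 : d <= 1 by rewrite ge_min lexx.
have dC : d * C <= e by rewrite -ler_pdivlMr// ge_min lexx orbT.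
have c'2 : c' ^+ 2 <= d by rewrite expr2; nra.
apply: le_trans dC; rewrite /C; have := sqr_ge0 c; nra.
Qed.

End SingularValues.

(** * Integrals over small intervals at 0 *)

Section Integrals.
Context {R : realType}.
Local Notation leb := (@lebesgue_measure R).
Implicit Types (f : R -> \bar R) (D : set R).

(** The preimages of the closed upper rays are intervals. *)
Lemma nonincreasing_emeasurable D f : measurable D ->
  (forall s t, s <= t -> (f t <= f s)%E) -> measurable_fun D f.
Proof.
move=> mD f_ni; apply: (measurability _ (ErealGenCInfty.measurableE R)) => //.
move=> /= _ [_ [r ->] <-]; apply: measurableI => //.
apply: is_interval_measurable => s t /=.
rewrite !in_itv/= !andbT => _ rt u /andP[_ ut].
by rewrite in_itv/= andbT (le_trans rt)// f_ni.
Qed.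

(** By monotone convergence the integrals over [F n] increase to the finite integral over the unit
    interval, so what is left near 0 becomes small. *)
Lemma integral_near0_le f (e : R) : measurable_fun (`]0%R, 1%R[%classic : set R) f ->
  (forall t, 0 < t -> (0 <= f t)%E) -> (\int[leb]_(t in `]0%R, 1%R[) f t < +oo)%E ->
  0 < e -> exists2 d, 0 < d & (\int[leb]_(t in `]0%R, d[) f t <= e%:E)%E.
Proof.
move=> mf f0 foo e0; pose F n : set R := `[(n.+1%:R^-1 : R), 1[%classic.
have FS n : F n `<=` `]0%R, 1%R[%classic.
  move=> t; rewrite /F/= !in_itv/= => /andP[nt ->]; rewrite andbT.
  by rewrite (lt_le_trans _ nt).
have mF n : measurable (F n) by exact: measurable_itv.
have FU : \bigcup_n F n = `]0%R, 1%R[%classic.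
  apply/seteqP; split => [t [n _] /FS//|t].
  rewrite /= in_itv/= => /andP[t0 t1].
  have := near_infty_natSinv_lt (PosNum t0) => -[n _ /(_ n (leqnn n))/= nt].
  by exists n => //; rewrite /F/= in_itv/= t1 ltW.
have f0' n t : F n t -> (0 <= f t)%E.
  by move=> /FS; rewrite /= in_itv/= => /andP[t0 _]; exact: f0.
have cF : ((\int[leb]_(x in F i) f x)%E @[i --> \oo] --> (\int[leb]_(x in `]0%R, 1%R[) f x)%E).
  rewrite -FU; apply: ge0_nondecreasing_set_cvg_integral => //.
  - move=> m n mn; apply/subsetPset => t; rewrite /F/= !in_itv/= => /andP[h ->].
    by rewrite andbT (le_trans _ h)// lef_pV2 ?posrE// ler_nat.
  - by move=> n; apply: measurable_funS mf; [exact: measurable_itv|exact: FS].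
have If : (\int[leb]_(x in `]0%R, 1%R[) f x)%E \is a fin_num.
  rewrite ge0_fin_numE//; apply: integral_ge0 => t.
  by rewrite /= in_itv/= => /andP[t0 _]; exact: f0.
set I := (\int[leb]_(x in `]0%R, 1%R[) f x)%E in foo cF If.
have lt : (I - e%:E < I)%E by rewrite lteBlDr// lteDl// lte_fin.
have [N _ /(_ N (leqnn N))/= FN] :
    \forall n \near \oo, (I - e%:E < \int[leb]_(t in F n) f t)%E.
  apply: (cF [set y | I - e%:E < y]%E); apply: open_nbhs_nbhs; split => //.
  exact: open_ereal_gt_ereal.
(* [d] is the left endpoint of [F N], so [F N] and the interval from 0 to [d] partition the unit
   interval. *)
pose d : R := N.+1%:R^-1; have d0 : 0 < d by rewrite invr_gt0.
have d1 : d <= 1 by rewrite invf_le1// ler1n.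
exists d => //; have : I = ((\int[leb]_(t in `]0%R, d[) f t) +
    (\int[leb]_(t in F N) f t))%E.
  have U : `]0%R, d[%classic `|` F N = `]0%R, 1%R[%classic.
    rewrite /F -/d; apply/seteqP; split => t /=; rewrite !in_itv/=.
      by move=> [/andP[-> td]|/andP[dt ->]]; rewrite ?(lt_le_trans td)// (lt_le_trans d0).
    by move=> /andP[t0 t1]; have [td|dt] := ltP t d; [left|right]; rewrite ?t0 ?t1 ?andbT.
  rewrite -ge0_integral_setU ?U//; first exact: mF.
    by move=> t /=; rewrite in_itv/= => /andP[t0 _]; exact: f0.
  rewrite disj_set2E; apply/eqP/seteqP; split => // t [].
  by rewrite /F/= -/d !in_itv/= => /andP[_ td] /andP[dt _]; move: (lt_le_trans td dt); rewrite ltxx.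
move: If FN; rewrite -/I => If FN IE; move: If FN; rewrite IE fin_numD => /andP[].
case: (\int[leb]_(t in `]0%R, d[) f t)%E => [A| |]// _.
case: (\int[leb]_(t in F N) f t)%E => [B| |]// _.
by rewrite lte_fin lee_fin; lra.
Qed.

(** On the interval from 0 to [s = min t0 d], [f] is bounded below by the positive constant
    [f s]. *)
Lemma integral_near0_gt0 f (d : R) : (forall s t, s <= t -> (f t <= f s)%E) ->
  (forall t, 0 < t -> (0 <= f t)%E) -> (exists2 t, 0 < t & (0 < f t)%E) ->
  0 < d -> (0 < \int[leb]_(t in `]0%R, d[) f t)%E.
Proof.
move=> f_ni f0 [t0 t00 ft0] d0; pose s := Num.min t0 d.
have s0 : 0 < s by rewrite lt_min t00.
have mf D : measurable D -> measurable_fun D f by move=> mD; exact: nonincreasing_emeasurable.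
have fs : (0 < f s)%E by rewrite (lt_le_trans ft0)// f_ni// ge_min lexx.
apply: (@lt_le_trans _ _ (\int[leb]_(t in `]0%R, s[) f t)%E); last first.
  apply: ge0_subset_integral => //; first exact: mf.
    by move=> t /=; rewrite in_itv/= => /andP[t0' _]; exact: f0.
  by apply: subset_itvl; rewrite bnd_simp ge_min lexx orbT.
apply: (@lt_le_trans _ _ (\int[leb]_(t in `]0%R, s[) cst (f s) t)%E).
  rewrite integral_cst//= lebesgue_measure_itv/= lte_fin s0 sube0.
  by rewrite mule_gt0.
apply: ge0_le_integral => //; last 2 first.
- exact: mf.
- by move=> t /=; rewrite in_itv/= => /andP[_ /ltW ts]; exact: f_ni.
- by move=> t _ /=; exact: ltW.
Qed.

End Integrals.

(** * Two-sided comparison of [tau_x] with integrals of [mu t x] *)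

Section WeightedTrace.
Context {R : realType} {H : completeNormedModType R[i]}.
Variable ip : {dot H for (@conjC R[i])}.
Hypothesis hip : is_inner_product ip.
Variable M : set (H -> H).
Hypothesis hM : von_neumann_algebra ip M.
Variable tau : (H -> H) -> \bar R.
Hypothesis htau : nsf_trace ip M tau.
Local Notation mu := (mu ip M tau).
Local Notation leb := (@lebesgue_measure R).
Implicit Types (x : set (H * H)) (q : H -> H) (d : R).

Lemma measurable_mu x (D : set R) : measurable D -> measurable_fun D (fun t => mu t x).
Proof. by move=> mD; apply: nonincreasing_emeasurable => // s t; exact: mu_nonincreasing. Qed.

Lemma measurable_mu_mul q x (D : set R) : measurable D ->
  measurable_fun D (fun t => mu t (graph q) * mu t x)%E.
Proof.
move=> mD; apply: nonincreasing_emeasurable => // s t st.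
by apply: lee_pmul; rewrite ?mu_ge0// mu_nonincreasing.
Qed.

(** The factor [mu t (graph q)] is at most 1 and vanishes from [d] on. *)
Lemma tau_x_le x q d : projections ip M q -> (tau q <= d%:E)%E ->
  (tau_x ip M tau x (graph q) <= \int[leb]_(t in `]0%R, d[) mu t x)%E.
Proof.
move=> qq qd; rewrite /tau_x.
have -> : `]0%R, d[%classic = `]0%R, +oo[%classic `&` `]-oo, d[%classic.
  by apply/seteqP; split => t /=; rewrite !in_itv/= andbT => /andP.
rewrite integral_mkcondr; apply: ge0_le_integral => //.
- by move=> t _; rewrite mule_ge0// mu_ge0.
- exact: measurable_mu_mul.
- by apply/measurable_restrict => //; apply: measurable_mu; exact: measurableI.
- move=> t /=; rewrite in_itv/= andbT => t0; rewrite patchE.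
  case: ifPn => [_|]; last first.
    rewrite notin_setE/= in_itv/= => /negP; rewrite -leNgt => dt.
    by rewrite (mu_projection_eq0 hM qq) ?mul0e// (le_trans qd).
  rewrite -[leRHS]mul1e lee_wpmul2r ?mu_ge0//.
  by apply: (mu_projection_le1 hip hM htau) => //; exact: ltW.
Qed.

(** For [t] below [d / 2] one has [2 t <= d < tau q], so [mu_projection_ge] applies. *)
Lemma tau_x_ge x q d : projections ip M q -> (d%:E < tau q)%E ->
  ((2^-1)%:E * \int[leb]_(t in `]0%R, (d / 2)%R[) mu t x <=
    tau_x ip M tau x (graph q))%E.
Proof.
move=> qq qd; rewrite -ge0_integralZl_EFin//; last 2 first.
- by move=> t _; exact: mu_ge0.
- exact: measurable_mu.
apply: (@le_trans _ _ (\int[leb]_(t in `]0%R, (d / 2)%R[) (mu t (graph q) * mu t x))%E).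
  apply: ge0_le_integral => //.
  - by move=> t _; rewrite mule_ge0// mu_ge0.
  - by apply: measurable_funeM; exact: measurable_mu.
  - exact: measurable_mu_mul.
  - move=> t /=; rewrite in_itv/= => /andP[t0 td].
    rewrite lee_wpmul2r ?mu_ge0// (mu_projection_ge hip hM htau)//.
    by apply: le_lt_trans qd; rewrite lee_fin; move: td; rewrite ltr_pdivlMr// mulrC => /ltW.
apply: ge0_subset_integral => //.
- exact: measurable_mu_mul.
- by move=> t _; rewrite mule_ge0// mu_ge0.
- by apply: subset_itvl; rewrite bnd_simp.
Qed.

Lemma L1_plus_M_closed x : L1_plus_M ip M tau x -> closed_operator x /\ affiliated ip M x.
Proof.
move=> [y [z [[[cly affy _] _] Mz ->]]]; have bz := vna_bounded hM Mz.
by split; [exact: strong_sum_closed|exact: strong_sum_affiliated].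
Qed.

(** The bounded summand contributes a constant, which is integrable on a bounded interval; this is
    why the bound stops at 1. *)
Lemma L1_plus_M_integral_lty x : L1_plus_M ip M tau x ->
  (\int[leb]_(t in `]0%R, 1%R[) mu t x < +oo)%E.
Proof.
move=> [y [z [[_ y1] Mz ->]]].
have [c c0 zc] := bounded_op_bound (vna_bounded hM Mz).
apply: (@le_lt_trans _ _ (\int[leb]_(t in `]0%R, 1%R[) (mu t y + cst c%:E t))%E).
  apply: ge0_le_integral => //.
  - by move=> t _; exact: mu_ge0.
  - exact: measurable_mu.
  - by apply: emeasurable_funD; [exact: measurable_mu|exact: measurable_cst].
  - by move=> t _; exact: (mu_strong_sum_le hip hM).
rewrite ge0_integralD//; last 2 first.
- by move=> t _; exact: mu_ge0.
- exact: measurable_mu.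
rewrite integral_cst//= lebesgue_measure_itv/= lte_fin ltr01 sube0 mule1.
rewrite lte_add_pinfty ?ltry//; apply: le_lt_trans y1.
apply: ge0_subset_integral => //; first exact: measurable_mu.
  by move=> t _; exact: mu_ge0.
by apply: subset_itvl; rewrite bnd_simp.
Qed.

End WeightedTrace.

Theorem theorem2p6 (R : realType) (H : completeNormedModType R[i])
  (ip : {dot H for (@conjC R[i])}) (hip : is_inner_product ip)
  (M : set (H -> H)) (hM : von_neumann_algebra ip M)
  (tau : (H -> H) -> \bar R) (htau : nsf_trace ip M tau)
  (x : set (H * H)) (hx : L1_plus_M ip M tau x) (hx0 : x <> graph (\0 : H -> H))
  (a : set (H * H)) (ha : closed_operator a) (haM : affiliated ip M a) :
  tau_measurable ip M tau a <-> tau_x_measurable ip M tau x a.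
Proof.
have [clx affx] := L1_plus_M_closed hM hx.
split=> -[_ _ ameas]; split => // d d0.
(* A tolerance [e] for [tau] is chosen so that the integral of [mu t x] up to [e] is within the
   tolerance [d] for [tau_x]. *)
- have [e e0 xe] := @integral_near0_le _ (fun t => mu ip M tau t x) d
    (measurable_mu _ _ _ _ (measurable_itv _)) (fun t _ => mu_ge0 _ _ _ _ _)
    (L1_plus_M_integral_lty hip hM hx) d0.
  have [p [pp pa ap pe]] := ameas _ e0; exists p; split => //.
  by apply: le_trans xe; apply: tau_x_le => //; exact: projections_compl.
- have I0 : (0 < (2^-1)%:E * \int[lebesgue_measure]_(t in `]0%R, (d / 2)%R[) mu ip M tau t x)%E.
    rewrite mule_gt0// ?lte_fin ?invr_gt0//; apply: integral_near0_gt0 => //.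
    + by move=> s t; exact: mu_nonincreasing.
    + by move=> t _; exact: mu_ge0.
    + exact: (mu_gt0 hip hM htau clx affx hx0).
    + by rewrite divr_gt0.
  (* [e] must lie strictly below the lower bound of [tau_x_ge]; an infinite bound is covered by
     [e = 1]. *)
  have [e e0 eI] : exists2 e : R, 0 < e & (e%:E < (2^-1)%:E *
      \int[lebesgue_measure]_(t in `]0%R, (d / 2)%R[) mu ip M tau t x)%E.
    move: I0; case: (_ * _)%E => [r| |]// r0; last by exists 1; rewrite ?ltry.
    by exists (r / 2); rewrite ?divr_gt0// lte_fin; move: r0; rewrite lte_fin; lra.
  have [p [pp pa ap pe]] := ameas _ e0; exists p; split => //.
  (* If [tau (1 - p)] exceeded [d], then [tau_x_ge] would push [tau_x (1 - p)] above [e]. *)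
  rewrite leNgt; apply/negP => dp; move: eI; apply/negP; rewrite -leNgt.
  apply: le_trans pe; apply: tau_x_ge => //; exact: projections_compl.
Qed.
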